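(* Let $K$ be the union of a finite number of real intervals, i.e. $K=[a_1,a_2]\cup[a_3,a_4]\cup\ldots\cup[a_{2\ell-1},a_{2\ell}]$ with real numbers $a_1<a_2<\ldots<a_{2\ell}$. Then for any polynomial $Q_n$ of degree $n$ ($n\in\mathbb{N}$), $$\frac{|Q_n(x)|}{\|Q_n\|_K}\leq\frac{1}{2}\bigl(\exp(n\cdot g(x;K^{\mathrm{c}}))+\exp(-n\cdot g(x;K^{\mathrm{c}}))\bigr)\qquad(x\in\mathbb{R}\setminus K),$$ where $g(x;K^{\mathrm{c}})$ denotes the Green's function of $K^{\mathrm{c}}$ (with pole at infinity). Equality is attained if and only if $Q_n$ is such that $Q_n^{-1}([-1,1])=K$.
   Context: Polynomials have complex coefficients. For a compact set $K\subset\mathbb{C}$ and a polynomial $P$, $\|P\|_K:=\max_{z\in K}|P(z)|$. Put $\overline{\mathbb{C}}:=\mathbb{C}\cup\{\infty\}$ and $K^{\mathrm{c}}:=\overline{\mathbb{C}}\setminus K$. The Green's function $g(z;K^{\mathrm{c}})$ of $K^{\mathrm{c}}$ with pole at infinity is the unique function such that: $g(z;K^{\mathrm{c}})$ is harmonic in $K^{\mathrm{c}}\setminus\{\infty\}$; $g(z;K^{\mathrm{c}})-\log|z|$ is harmonic in a neighbourhood of infinity; and $g(z;K^{\mathrm{c}})\to 0$ as $z\to K$, $z\in K^{\mathrm{c}}$. For a polynomial $P$, $P^{-1}([-1,1]):=\{z\in\mathbb{C}: P(z)\in[-1,1]\}$.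
   Formalization: Equality is characterized up to a constant factor: it holds iff some nonzero complex multiple cQ_n satisfies (cQ_n)^{-1}([-1,1])=K; the literal ''only if'' fails for K=[-1,1], Q_1(z)=2z. The degree n is taken to be at least 1. *)

(* Defs.v *)
From HB Require Import structures.
From mathcomp Require Export all_boot all_order all_algebra.
From mathcomp Require Export complex.
From mathcomp Require Export all_classical all_reals all_analysis.
Export numFieldNormedType.Exports.
Export Order.TTheory GRing.Theory Num.Theory.

Set Implicit Arguments.
Unset Strict Implicit.
Unset Printing Implicit Defensive.

Global Open Scope classical_set_scope.
Global Open Scope ring_scope.
Global Open Scope complex_scope.

(* [R[i]] carries no structure of normed space over [R] in the libraries, so
   differential calculus is done on [R * R], identified with [R[i]] by
   [of_plane]. *)
Definition of_plane (R : realType) (p : R * R) : R[i] := p.1 +i* p.2.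

Definition dx (R : realType) (u : R * R -> R) : R * R -> R :=
  fun p => 'D_((1, 0) : R * R) u p.

Definition dy (R : realType) (u : R * R -> R) : R * R -> R :=
  fun p => 'D_((0, 1) : R * R) u p.

(* The next three predicates are meant for an open [U]. *)
Definition C1_on (R : realType) (U : set (R * R)) (u : R * R -> R) : Prop :=
  forall p, U p ->
    [/\ derivable u p ((1, 0) : R * R), derivable u p ((0, 1) : R * R),
        {for p, continuous (dx u)} & {for p, continuous (dy u)}].

Definition C2_on (R : realType) (U : set (R * R)) (u : R * R -> R) : Prop :=
  [/\ C1_on U u, C1_on U (dx u) & C1_on U (dy u)].

Definition harmonic_on (R : realType) (U : set (R[i])) (u : R[i] -> R) : Prop :=
  let V : set (R * R) := @of_plane R @^-1` U in
  let v : R * R -> R := u \o @of_plane R in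
  C2_on V v /\ forall p, V p -> dx (dx v) p + dy (dy v) p = 0.

Definition cabs (R : realType) (z : R[i]) : R := Normc.normc z.

(* Harmonicity in a neighbourhood of the point at infinity of the Riemann
   sphere: in the chart [w = 1/z], [f] extends to a harmonic function on a disc
   centred at [0]. *)
Definition harmonic_near_infinity (R : realType) (f : R[i] -> R) : Prop :=
  exists (r : R) (h : R[i] -> R),
    [/\ 0 < r, harmonic_on [set w | cabs w < r] h
      & forall w, 0 < cabs w < r -> h w = f w^-1].

(* [g] is the Green's function, with pole at infinity, of the complement of the
   compact set [K]; the values of [g] on [K] are irrelevant.  In the last clause
   [z -> K] means that the distance from [z] to [K] tends to [0]. *)
Definition is_green (R : realType) (K : set (R[i])) (g : R[i] -> R) : Prop :=
  [/\ harmonic_on (~` K) g,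
      harmonic_near_infinity (fun z => g z - ln (cabs z))
    & forall e : R, 0 < e -> exists2 d : R, 0 < d &
        forall z, ~ K z -> (exists2 k, K k & cabs (z - k) < d) ->
          `|g z| < e].

(* The supremum is a maximum when [K] is compact and nonempty. *)
Definition poly_norm (R : realType) (K : set (R[i])) (P : {poly R[i]}) : R :=
  sup [set cabs P.[z] | z in K].

Definition poly_preimage (R : realType) (P : {poly R[i]}) : set (R[i]) :=
  [set z | exists2 t : R, -1 <= t <= 1 & P.[z] = t%:C].

(* The union of the [l] intervals [a 0, a 1], [a 2, a 3], ...,
   [a (2 l - 2), a (2 l - 1)], as a subset of the complex plane. *)
Definition real_intervals (R : realType) (l : nat) (a : nat -> R) : set (R[i]) :=
  [set z | exists k : nat, exists x : R,
     [/\ (k < l)%N, a k.*2 <= x <= a k.*2.+1 & z = x%:C]].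

(* Main.v *)
From mathcomp Require Import ring lra zify.
From mathcomp Require Import separable.
Require Import Defs.

(* Let [T] be a polynomial of degree [n] mapping [K] into [-1, 1], and let [v] be
   the composition of [T] with the Green's function of the complement of
   [-1, 1].  Then [v] vanishes on [K], is subharmonic, and grows like [n ln |z|],
   so the minimum principle gives [v <= n g] off [K]; where [T] is real of
   modulus at least 1 this reads [|T| <= cosh (n g)].  Off [K] the function
   [n g - v] is nonnegative and superharmonic, so if it vanishes at one point it
   vanishes identically by the strong minimum principle, and then
   [T^-1([-1, 1]) = K].  Conversely, if [T^-1([-1, 1]) = K], then [v] is harmonic
   off [K] and [v = n g].  A complex [Q] is first rotated so that [Q(x) >= 0] and
   replaced by its real part [T] on the real line; in the case of equality its
   imaginary part vanishes at all points where [T = 1] or [T = -1], and there are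
   more than [n] of them. *)

Set Implicit Arguments.
Unset Strict Implicit.
Unset Printing Implicit Defensive.

(** Proving directly that [v] is harmonic where it is positive would call for the analytic inverse
    of the Joukowski map [z => (z + z^-1) / 2]. Instead, [v] is a limit of [2 ^- k * ln |T_k|],
    where [T_k] is [T] followed by the Chebyshev polynomial of degree [2 ^ k]. Derivatives need not
    pass to such a limit, but bounds on a discrete Laplacian, a combination of five values, do. The
    zeros of all the [T_k] lie where [v = 0], so they do not disturb the limit where [v > 0]. The
    hyperbolic cosine enters as [cosh (ln |z|) = (|z| + |z|^-1) / 2], which is [|T|] where [T] is
    real of modulus at least 1. The points where [T = 1] or [T = -1] outnumber [n] because
    [T ^+ 2 - 1] has degree [2 n] and its multiplicities are absorbed by the derivative of [T], of
    degree [n - 1]. The left-hand side of the inequality does not change when [Q] is multiplied by a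
    nonzero constant, so equality can only characterise [Q] up to such a factor. *)

Local Notation Re := complex.Re.
Local Notation Im := complex.Im.

(** * The minimum principle *)

Section DiscreteLaplacian.
Context {R : realType}.
Implicit Types (f g : R * R -> R) (p : R * R) (D : set (R * R)).

(* Five-point discrete Laplacian; it replaces second derivatives, so that limits
   of logarithms of polynomials can be handled without differentiating them. *)
Definition lap f p (t : R) : R :=
  f (p.1 + t, p.2) + f (p.1 - t, p.2) + f (p.1, p.2 + t) + f (p.1, p.2 - t)
  - 4 * f p.

(** A pointwise bound: the upper limit of [lap f p t / t ^+ 2] as [t] decreases to 0 is at most 0.
    Together with continuity this is all that the minimum principle asks for. *)
Definition superharm f p :=
  forall e : R, 0 < e -> \forall t \near 0^'+, lap f p t <= e * t ^+ 2.

Lemma superharmD f g p :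
  superharm f p -> superharm g p -> superharm (fun q => f q + g q) p.
Proof.
move=> sf sg e e0; have e20 : 0 < e / 2 by rewrite divr_gt0.
near=> t.
have h1 : lap f p t <= e / 2 * t ^+ 2 by near: t; exact: sf.
have h2 : lap g p t <= e / 2 * t ^+ 2 by near: t; exact: sg.
move: h1 h2; rewrite /lap; lra.
Unshelve. all: by end_near. Qed.

Lemma superharmZ (k : R) f p :
  0 <= k -> superharm f p -> superharm (fun q => k * f q) p.
Proof.
move=> k0 sf e e0; have k1 : 0 < k + 1 by lra.
near=> t.
have h1 : lap f p t <= e / (k + 1) * t ^+ 2.
  by near: t; apply: sf; rewrite divr_gt0.
have -> : lap (fun q => k * f q) p t = k * lap f p t by rewrite /lap; ring.
apply: le_trans (ler_wpM2l k0 h1) _.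
rewrite mulrA ler_wpM2r ?sqr_ge0//.
rewrite mulrA ler_pdivrMr//; nra.
Unshelve. all: by end_near. Qed.

Lemma superharm_cst (k : R) p : superharm (fun=> k) p.
Proof.
move=> e e0; near=> t; rewrite /lap.
have -> : k + k + k + k - 4 * k = 0 by ring.
by rewrite mulr_ge0 ?sqr_ge0// ltW.
Unshelve. all: by end_near. Qed.

Lemma near_axes p (P : R * R -> Prop) : (\forall q \near p, P q) ->
  \forall t \near 0^'+,
    [/\ P (p.1 + t, p.2), P (p.1 - t, p.2), P (p.1, p.2 + t) & P (p.1, p.2 - t)].
Proof.
case: p => x y [[A B] [/= nA nB] AB].
have [e e0 eA] : exists2 e : R, 0 < e & forall z, `|z - x| < e -> A z.
  case/nbhs_ballP: nA => e e0 h; exists e => // z hz; apply: h.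
  by rewrite /ball/= distrC.
have [d d0 dB] : exists2 d : R, 0 < d & forall z, `|z - y| < d -> B z.
  case/nbhs_ballP: nB => d d0 h; exists d => // z hz; apply: h.
  by rewrite /ball/= distrC.
near=> t.
have t0 : 0 < t by near: t; exact: nbhs_right_gt.
have te : t < e by near: t; exact: nbhs_right_lt.
have td : t < d by near: t; exact: nbhs_right_lt.
have h1 z : `|z + t - z| < e by rewrite addrAC subrr add0r gtr0_norm.
have h2 z : `|z - t - z| < e by rewrite addrAC subrr add0r normrN gtr0_norm.
have h3 z : `|z + t - z| < d by rewrite addrAC subrr add0r gtr0_norm.
have h4 z : `|z - t - z| < d by rewrite addrAC subrr add0r normrN gtr0_norm.
split; apply: AB; split => /=; first [exact: eA | exact: dB | idtac];
 by [apply: eA; rewrite subrr normr0 | apply: dB; rewrite subrr normr0].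
Unshelve. all: by end_near. Qed.

Definition sqn (p : R * R) : R := p.1 ^+ 2 + p.2 ^+ 2.

Lemma continuous_sqn : continuous sqn.
Proof.
move=> p; apply: cvgD; apply: cvgM; first [exact: cvg_fst | exact: cvg_snd].
Qed.

Lemma sqn_ge0 p : 0 <= sqn p.
Proof. by rewrite addr_ge0 ?sqr_ge0. Qed.

(* Perturbing by [- d * sqn] makes the discrete Laplacian strictly negative, so
   that no interior minimum is possible. *)
Lemma min_principle D f :
  open D -> (forall p, D p -> {for p, continuous f}) ->
  (forall p, D p -> superharm f p) ->
  (forall e, 0 < e -> exists2 C, compact C &
     C `<=` D /\ forall p, D p -> ~ C p -> - e <= f p) ->
  forall p, D p -> 0 <= f p.
Proof.
move=> oD cf sf bf p Dp; rewrite leNgt; apply/negP => fp0.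
(* A third suffices: as [d * sqn <= e] on [C], the minimum point [c] of [fd] satisfies
   [f c <= - 2 * e]. *)
pose e := - f p / 3; have e0 : 0 < e by rewrite /e; lra.
have [C cC [CD Cf]] := bf _ e0.
have Cp : C p by apply: contrapT => /(Cf _ Dp); rewrite /e; lra.
have C0 : C !=set0 by exists p.
have [M M0 MC] : exists2 M : R, 0 < M & forall q, C q -> sqn q <= M.
  have [|c cin cmax] := @compact_EVT_max _ R sqn C C0 cC.
    exact/continuous_subspaceT/continuous_sqn.
  exists (sqn c + 1); first by have := sqn_ge0 c; lra.
  by move=> q Cq; have := cmax q; rewrite inE => /(_ Cq); lra.
pose d := e / M; have d0 : 0 < d by rewrite divr_gt0.
have dM : d * M = e by rewrite /d -mulrA mulVf ?mulr1// gt_eqF.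
pose fd q := f q + (- d) * sqn q.
have [|c + cmin] := @compact_EVT_min _ R fd C C0 cC.
  apply: continuous_in_subspaceT => q; rewrite inE => Cq.
  apply: (@cvgD _ _ _ _ _ f (fun q => - d * sqn q)); first exact/cf/CD.
  by apply: cvgM; [exact: cvg_cst|exact: continuous_sqn].
rewrite inE => Cc.
have fc : f c < - e.
  have := cmin p; rewrite inE => /(_ Cp); rewrite /fd.
  have h1 := MC _ Cc; have h2 := sqn_ge0 p.
  have h3 : d * sqn c <= e by rewrite -dM ler_wpM2l// ltW.
  have h4 : 0 <= d * sqn p by rewrite mulr_ge0// ltW.
  by rewrite /e in h3 *; lra.
(* Near [c] the values of [f] stay below [- e], which does not happen in [D] outside [C]; so the
   minimum over [C] is a local one. *)
have Cn : \forall q \near c, C q.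
  have Dn : \forall q \near c, D q by apply: open_nbhs_nbhs; split => //; exact: CD.
  have fn : \forall q \near c, f q < - e.
    have := @cvgr_lt _ _ _ _ _ _ (cf _ (CD _ Cc)) (- e) fc; exact.
  near=> q; apply: contrapT => Cq.
  have : f q < - e by near: q.
  by rewrite ltNge Cf//; near: q.
have := near_axes Cn; have := sf _ (CD _ Cc) _ d0 => h1 h2.
have [t [t0 [h3 [c1 c2 c3 c4]]]] : exists t, 0 < t /\ lap f c t <= d * t ^+ 2 /\
    [/\ C (c.1 + t, c.2), C (c.1 - t, c.2), C (c.1, c.2 + t) & C (c.1, c.2 - t)].
  near (0:R)^'+ => t; exists t; split; last split; near: t => //.
  exact: nbhs_right_gt.
have := cmin (c.1 + t, c.2); rewrite inE => /(_ c1).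
have := cmin (c.1 - t, c.2); rewrite inE => /(_ c2).
have := cmin (c.1, c.2 + t); rewrite inE => /(_ c3).
have := cmin (c.1, c.2 - t); rewrite inE => /(_ c4).
(* Since [lap sqn c t = 4 * t ^+ 2], a local minimum of [fd] at [c] would force
   [lap f c t >= 4 * d * t ^+ 2]. *)
move: h3; rewrite /fd /lap /sqn /=.
have := mulr_gt0 d0 (exprn_gt0 2 t0).
nra.
Unshelve. all: by end_near. Qed.

End DiscreteLaplacian.

(** * Harmonic functions *)

Section HarmonicFunctions.
Context {R : realType}.
Implicit Types (v : R * R -> R) (p e : R * R) (V : set (R * R)).

Lemma is_derive_line v p e (s : R) : derivable v (s *: e + p) e ->
  is_derive s 1 (fun r : R => v (r *: e + p)) ('D_e v (s *: e + p)).
Proof.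
move=> dv; pose w (r : R) := v (r *: e + p).
have E : (fun h : R => h^-1 *: (w (h *: 1 + s) - w s)) =
         (fun h : R => h^-1 *: (v (h *: e + (s *: e + p)) - v (s *: e + p))).
  apply/funext => h; rewrite /w; congr (_ *: (v _ - _)).
  by rewrite [h *: _]mulr1 scalerDl addrA.
apply: DeriveDef; first by rewrite /derivable E.
by rewrite /derive E.
Qed.

Lemma mean_value_le (w dw : R -> R) (M h : R) :
  (forall s : R, `|s| <= `|h| -> is_derive s 1 w (dw s) /\ `|dw s| <= M) ->
  `|w h - w 0| <= M * `|h|.
Proof.
move=> H.
have aux a b : a <= b -> (forall s, a <= s <= b -> `|s| <= `|h|) ->
    `|w b - w a| <= M * (b - a).
  move=> ab abh.
  have D s : a <= s <= b -> is_derive s 1 w (dw s).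
    by move=> sab; apply: (H _ _).1; exact: abh.
  have [s|s|c] := @MVT_segment R w dw a b ab.
  - by rewrite in_itv/= => /andP[/ltW s1 /ltW s2]; apply: D; rewrite s1.
  - apply: derivable_within_continuous s => s; rewrite in_itv/= => sab.
    by have [] := D _ sab.
  rewrite in_itv/= => cab ->; rewrite normrM (ger0_norm (_ : 0 <= b - a)) ?subr_ge0//.
  by rewrite ler_wpM2r ?subr_ge0//; exact: (H _ (abh _ cab)).2.
have [h0|h0] := leP 0 h.
  have := aux 0 h h0; rewrite (ger0_norm h0) subr0; apply => s /andP[s0 sh].
  by rewrite ger0_norm.
have := aux h 0 (ltW h0); rewrite (ltr0_norm h0) sub0r distrC; apply => s /andP[sh s0].
by rewrite ler0_norm ?lerN2.
Qed.

(** Locally bounded partial derivatives make [v] Lipschitz along each axis; [q] is joined to [p]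
    through the corner [(p.1, q.2)]. *)
Lemma C1_on_continuous V v : open V -> C1_on V v ->
  forall p, V p -> {for p, continuous v}.
Proof.
move=> oV C1 p Vp; have [_ _ cx cy] := C1 _ Vp.
pose M := Num.max `|dx v p| `|dy v p| + 1.
have M0 : 0 < M by rewrite /M ltr_wpDl// le_max normr_ge0.
have : \forall q \near p, [/\ V q, `|dx v q| < M & `|dy v q| < M].
  have h1 : \forall q \near p, V q by apply: open_nbhs_nbhs.
  have h2 : \forall q \near p, `|dx v q| < M.
    by apply: (cvgr_lt `|dx v p| (cvg_norm cx)); rewrite /M ltr_pwDr// le_max lexx.
  have h3 : \forall q \near p, `|dy v q| < M.
    by apply: (cvgr_lt `|dy v p| (cvg_norm cy)); rewrite /M ltr_pwDr// le_max lexx orbT.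
  by apply: filterS3 h1 h2 h3 => q.
case => -[A B] [/= nA nB] AB.
have [a a0 aA] : exists2 a : R, 0 < a & forall z, `|z - p.1| < a -> A z.
  case/nbhs_ballP: nA => a a0 h; exists a => // z hz; apply: h.
  by rewrite /ball/= distrC.
have [b b0 bB] : exists2 b : R, 0 < b & forall z, `|z - p.2| < b -> B z.
  case/nbhs_ballP: nB => b b0 h; exists b => // z hz; apply: h.
  by rewrite /ball/= distrC.
have key q : `|q.1 - p.1| < a -> `|q.2 - p.2| < b ->
    `|v q - v p| <= M * `|q.1 - p.1| + M * `|q.2 - p.2|.
  move=> qa qb.
  have h1 : `|v q - v (p.1, q.2)| <= M * `|q.1 - p.1|.
    have := @mean_value_le (fun s : R => v (s *: ((1, 0) : R * R) + (p.1, q.2)))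
      (fun s => dx v (s *: ((1, 0) : R * R) + (p.1, q.2))) M (q.1 - p.1).
    rewrite scale0r add0r.
    have -> : (q.1 - p.1) *: ((1, 0) : R * R) + (p.1, q.2) = q.
      by rewrite [LHS]surjective_pairing /= /GRing.scale/= mulr1 mulr0 add0r subrK -surjective_pairing.
    apply => s sh.
    have [Vs xs ys] : [/\ V (s *: ((1, 0) : R * R) + (p.1, q.2)),
       `|dx v (s *: ((1, 0) : R * R) + (p.1, q.2))| < M &
       `|dy v (s *: ((1, 0) : R * R) + (p.1, q.2))| < M].
      apply: AB; split => /=; rewrite /GRing.scale/= ?mulr1 ?mulr0 ?add0r.
        by apply: aA; rewrite addrK; exact: le_lt_trans qa.
      exact: bB.
    split; last exact: ltW.
    by apply: is_derive_line; have [] := C1 _ Vs.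
  have h2 : `|v (p.1, q.2) - v p| <= M * `|q.2 - p.2|.
    have := @mean_value_le (fun s : R => v (s *: ((0, 1) : R * R) + p))
      (fun s => dy v (s *: ((0, 1) : R * R) + p)) M (q.2 - p.2).
    rewrite scale0r add0r.
    have -> : (q.2 - p.2) *: ((0, 1) : R * R) + p = (p.1, q.2).
      by rewrite [LHS]surjective_pairing /= /GRing.scale/= mulr1 mulr0 add0r subrK.
    apply => s sh.
    have [Vs xs ys] : [/\ V (s *: ((0, 1) : R * R) + p),
       `|dx v (s *: ((0, 1) : R * R) + p)| < M &
       `|dy v (s *: ((0, 1) : R * R) + p)| < M].
      apply: AB; split => /=; rewrite /GRing.scale/= ?mulr1 ?mulr0 ?add0r.
        by apply: aA; rewrite subrr normr0.
      by apply: bB; rewrite addrK; exact: le_lt_trans qb.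
    split; last exact: ltW.
    by apply: is_derive_line; have [] := C1 _ Vs.
  have := ler_normD (v q - v (p.1, q.2)) (v (p.1, q.2) - v p).
  by rewrite addrA subrK; lra.
have c1 : (fun q : R * R => q.1) @ p --> p.1 by case: (p) => ? ?; exact: cvg_fst.
have c2 : (fun q : R * R => q.2) @ p --> p.2 by case: (p) => ? ?; exact: cvg_snd.
apply/cvgrPdist_le => e e0.
have ea : 0 < Num.min a (e / (2 * M)) by rewrite lt_min a0 divr_gt0// mulr_gt0.
have eb : 0 < Num.min b (e / (2 * M)) by rewrite lt_min b0 divr_gt0// mulr_gt0.
near=> q.
have n1 : `|p.1 - q.1| < Num.min a (e / (2 * M)).
  by near: q; move/cvgrPdist_lt : c1 => /(_ _ ea).
have n2 : `|p.2 - q.2| < Num.min b (e / (2 * M)).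
  by near: q; move/cvgrPdist_lt : c2 => /(_ _ eb).
move: n1 n2; rewrite !lt_min (distrC p.1) (distrC p.2) => /andP[n1 /ltW n1'] /andP[n2 /ltW n2'].
rewrite distrC; apply: le_trans (key _ n1 n2) _.
have := ler_wpM2l (ltW M0) n1'; have := ler_wpM2l (ltW M0) n2'.
have -> : M * (e / (2 * M)) = e / 2 by field; rewrite gt_eqF.
lra.
Unshelve. all: by end_near. Qed.

(** The mean value inequality is applied to the even function [u s = w s + w (- s) - 2 * w 0 - c * s
    ^+ 2], whose derivative is at most [e * |s|] near 0 because [dw] has derivative [c] there. *)
Lemma second_difference (w dw : R -> R) (c : R) :
  (\forall s \near (0:R), is_derive (s : R) 1 w (dw s)) -> is_derive (0:R) 1 dw c ->
  forall e : R, 0 < e -> \forall t \near 0^'+,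
    `|w t + w (- t) - 2 * w 0 - c * t ^+ 2| <= e * t ^+ 2.
Proof.
move=> Hw [ddw Ddw] e e0.
have [r r0 rw] : exists2 r : R, 0 < r & forall s : R, `|s| < r -> is_derive s 1 w (dw s).
  case/nbhs_ballP: Hw => r r0 h; exists r => // s hs; apply: h.
  by rewrite /ball/= distrC subr0.
have [d d0 dl] : exists2 d : R, 0 < d & forall s, `|s| < d ->
    `|dw s - dw 0 - c * s| <= e / 2 * `|s|.
  have : (fun h : R => h^-1 *: (dw (h *: 1 + 0) - dw 0)) @ 0^' --> c.
    by rewrite -Ddw; exact: ddw.
  move/cvgrPdist_lt => /(_ (e / 2)); rewrite divr_gt0// => /(_ isT).
  case/nbhs_ballP => d d0 h; exists d => // s hs.
  have [->|s0] := eqVneq s 0; first by rewrite subrr mulr0 subrr !normr0 mulr0.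
  have := h s; rewrite /ball/= distrC subr0 => /(_ hs s0)/ltW.
  rewrite /GRing.scale/= mulr1 addr0 => hh.
  have -> : dw s - dw 0 - c * s = - (c - s^-1 * (dw s - dw 0)) * s by field.
  by rewrite normrM normrN ler_wpM2r.
near=> t.
have t0 : 0 < t by near: t; exact: nbhs_right_gt.
have tr : t < r by near: t; exact: nbhs_right_lt.
have td : t < d by near: t; exact: nbhs_right_lt.
pose u (s : R) := w s + w (- s) - 2 * w 0 - c * s ^+ 2.
have u0 : u 0 = 0 by rewrite /u oppr0; ring.
have -> : w t + w (- t) - 2 * w 0 - c * t ^+ 2 = u t - u 0 by rewrite u0 subr0.
have -> : e * t ^+ 2 = e * t * `|t| by rewrite gtr0_norm//; ring.
apply: (@mean_value_le u (fun s => dw s - dw (- s) - c * (2 * s))) => s.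
rewrite (gtr0_norm t0) => st.
have sr : `|s| < r by exact: le_lt_trans tr.
have sd : `|s| < d by exact: le_lt_trans td.
split.
  have h1 := rw _ sr.
  have h2 : is_derive (- s) 1 w (dw (- s)) by apply: rw; rewrite normrN.
  have h3 : is_derive s 1 (fun s => w (- s)) (- dw (- s)).
    have dN : is_derive s 1 (fun s : R => - s) (- 1) by exact: is_deriveN.
    have := @is_derive1_comp _ w (fun s : R => - s) s _ _ h2 dN.
    by rewrite mulrN1.
  rewrite /u; apply: is_derive_eq.
  by rewrite /GRing.scale/=; ring.
have k1 := dl _ sd; have := dl (- s); rewrite normrN => /(_ sd) k2.
have -> : dw s - dw (- s) - c * (2 * s) = (dw s - dw 0 - c * s) - (dw (- s) - dw 0 - c * - s).
  by ring.
apply: le_trans (ler_normB _ _) _.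
apply: le_trans (_ : e * `|s| <= _); first lra.
by rewrite ler_wpM2l// ltW.
Unshelve. all: by end_near. Qed.

(** The five-point Laplacian is the sum of the second differences along the two axes, hence equals
    [t ^+ 2] times the vanishing Laplacian up to an arbitrarily small multiple of [t ^+ 2]. *)
Lemma harmonic_on_superharm (U : set R[i]) (u : R[i] -> R) :
  open (@of_plane R @^-1` U) -> harmonic_on U u -> forall p, U (of_plane p) ->
  superharm (fun q => u (of_plane q)) p /\
  superharm (fun q => - u (of_plane q)) p.
Proof.
move=> oU [[C1 C1x C1y] L] p Up.
pose v q := u (of_plane q).
have dir (e : R * R) (dv : R * R -> R) :
    (forall q, U (of_plane q) -> derivable v q e) ->
    dv = (fun q => 'D_e v q) -> derivable dv p e ->
    forall r : R, 0 < r -> \forall t \near 0^'+,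
     `|v (t *: e + p) + v (- t *: e + p) - 2 * v p - 'D_e dv p * t ^+ 2| <= r * t ^+ 2.
  move=> Dv Edv Ddv r r0.
  have := @second_difference (fun t => v (t *: e + p)) (fun t => dv (t *: e + p)) ('D_e dv p).
  rewrite scale0r add0r; apply => //.
    have cl : (fun s : R => s *: e + p) @ (0:R) --> p.
      have : (fun s : R => s *: e + p) @ (0:R) --> 0 *: e + p.
        by apply: cvgD; [apply: cvgZ; [exact: cvg_id|exact: cvg_cst]|exact: cvg_cst].
      by rewrite scale0r add0r.
    have : \forall s \near (0:R), U (of_plane (s *: e + p)).
      have nU : nbhs p (@of_plane R @^-1` U) by exact: open_nbhs_nbhs.
      exact: (cl _ nU).
    apply: filterS => s Us; rewrite Edv; apply: is_derive_line; exact: Dv.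
  have := @is_derive_line dv p e 0; rewrite scale0r add0r; exact.
have ex (t : R) : t *: ((1, 0) : R * R) + p = (p.1 + t, p.2).
  by rewrite [LHS]surjective_pairing/= /GRing.scale/= mulr1 mulr0 add0r addrC.
have ey (t : R) : t *: ((0, 1) : R * R) + p = (p.1, p.2 + t).
  by rewrite [LHS]surjective_pairing/= /GRing.scale/= mulr1 mulr0 add0r addrC.
have hx (r : R) : 0 < r -> \forall t \near 0^'+,
    `|v (p.1 + t, p.2) + v (p.1 - t, p.2) - 2 * v p - dx (dx v) p * t ^+ 2| <= r * t ^+ 2.
  move=> r0.
  apply: filterS (dir _ (dx v) (fun q Uq => let: And4 a _ _ _ := C1 q Uq in a) erefl
    (let: And4 a _ _ _ := C1x p Up in a) r r0) => t.
  by rewrite (ex t) (ex (- t)).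
have hy (r : R) : 0 < r -> \forall t \near 0^'+,
    `|v (p.1, p.2 + t) + v (p.1, p.2 - t) - 2 * v p - dy (dy v) p * t ^+ 2| <= r * t ^+ 2.
  move=> r0.
  apply: filterS (dir _ (dy v) (fun q Uq => let: And4 _ a _ _ := C1 q Uq in a) erefl
    (let: And4 _ a _ _ := C1y p Up in a) r r0) => t.
  by rewrite (ey t) (ey (- t)).
have Lp : dx (dx v) p + dy (dy v) p = 0 by exact: L.
split=> e e0; have e20 : 0 < e / 2 by rewrite divr_gt0.
- apply: (filterS2 _ _ (hx _ e20) (hy _ e20)) => t /ler_normlP[_ a2] /ler_normlP[_ b2].
  rewrite /lap -/(v _).
  by move: (dx (dx v) p) (dy (dy v) p) a2 b2 Lp => A B; rewrite /v => *; nra.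
- apply: (filterS2 _ _ (hx _ e20) (hy _ e20)) => t /ler_normlP[a1 _] /ler_normlP[b1 _].
  rewrite /lap.
  by move: (dx (dx v) p) (dy (dy v) p) a1 b1 Lp => A B; rewrite /v => *; nra.
Qed.

Lemma harmonic_on_continuous (U : set R[i]) (u : R[i] -> R) :
  open (@of_plane R @^-1` U) -> harmonic_on U u -> forall p, U (of_plane p) ->
  {for p, continuous (fun q => u (of_plane q))}.
Proof. by move=> oU [[C1 _ _] _] p; exact: (C1_on_continuous oU C1). Qed.

End HarmonicFunctions.

(** * The complex modulus and the topology of the plane *)

Section ComplexPlane.
Context {R : realType}.
Implicit Types (z w y : R[i]) (p q : R * R) (P : {poly R[i]}).

Lemma cabs_ge0 z : 0 <= cabs z.
Proof. by case: z => a b; exact: sqrtr_ge0. Qed.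

Lemma cabsE z : cabs z = Num.sqrt (Re z ^+ 2 + Im z ^+ 2).
Proof. by case: z. Qed.

Lemma sqr_cabs z : cabs z ^+ 2 = Re z ^+ 2 + Im z ^+ 2.
Proof. by rewrite cabsE sqr_sqrtr// addr_ge0 ?sqr_ge0. Qed.

Lemma cabsM z w : cabs (z * w) = cabs z * cabs w.
Proof. exact: Normc.normcM. Qed.

Lemma cabsV z : cabs z^-1 = (cabs z)^-1.
Proof. exact: Normc.normcV. Qed.

Lemma cabs1 : cabs (1 : R[i]) = 1.
Proof. exact: Normc.normc1. Qed.

Lemma cabs0 : cabs (0 : R[i]) = 0.
Proof. exact: Normc.normc0. Qed.

Lemma cabsX z k : cabs (z ^+ k) = cabs z ^+ k.
Proof.
elim: k => [|k IH]; first by rewrite !expr0 cabs1.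
by rewrite !exprS cabsM IH.
Qed.

Lemma cabsN z : cabs (- z) = cabs z.
Proof. by rewrite !cabsE !raddfN /= !sqrrN. Qed.

Lemma cabs_real (t : R) : cabs t%:C = `|t|.
Proof. by rewrite cabsE /= expr0n addr0 sqrtr_sqr. Qed.

Lemma cabsD z w : cabs (z + w) <= cabs z + cabs w.
Proof. exact: le_normcD. Qed.

Lemma cabsB z w : cabs z - cabs w <= cabs (z - w).
Proof. by rewrite lerBlDr; apply: le_trans (cabsD _ _); rewrite subrK. Qed.

Lemma cabs_distC z w : cabs (z - w) = cabs (w - z).
Proof. by rewrite -cabsN opprB. Qed.

Lemma cabs_eq0 z : (cabs z == 0) = (z == 0).
Proof.
apply/eqP/eqP => [|->]; [exact: Normc.eq0_normc|exact: cabs0].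
Qed.

Lemma cabs_gt0 z : (0 < cabs z) = (z != 0).
Proof. by rewrite lt_def cabs_ge0 andbT cabs_eq0. Qed.

Lemma ge_Re_cabs z : `|Re z| <= cabs z.
Proof. by rewrite cabsE -sqrtr_sqr ler_wsqrtr// lerDl sqr_ge0. Qed.

Lemma ge_Im_cabs z : `|Im z| <= cabs z.
Proof. by rewrite cabsE -sqrtr_sqr ler_wsqrtr// lerDr sqr_ge0. Qed.

Lemma cabs_plane_le p q :
  cabs (of_plane q - of_plane p) <= `|q.1 - p.1| + `|q.2 - p.2|.
Proof.
case: p q => [a b] [c d]; rewrite [_ - _]complexE; apply: le_trans (cabsD _ _) _.
by rewrite cabsM !cabs_real cabsE/= expr0n expr1n add0r sqrtr1 mul1r.
Qed.

Lemma continuous_cabs_comp (F : R * R -> R[i]) :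
  continuous (fun p => Re (F p)) -> continuous (fun p => Im (F p)) ->
  continuous (fun p => cabs (F p)).
Proof.
move=> cR cI p.
have -> : (fun p => cabs (F p)) = Num.sqrt \o (fun p => Re (F p) ^+ 2 + Im (F p) ^+ 2).
  by apply/funext => q; rewrite /= cabsE.
apply: continuous_comp; last exact: sqrt_continuous.
apply: (@cvgD _ _ _ _ _ (fun p => Re (F p) ^+ 2) (fun p => Im (F p) ^+ 2)).
  by under eq_fun do rewrite expr2; apply: cvgM; exact: cR.
by under eq_fun do rewrite expr2; apply: cvgM; exact: cI.
Qed.

Lemma continuous_horner_plane P :
  continuous (fun p => Re P.[of_plane p]) /\ continuous (fun p => Im P.[of_plane p]).
Proof.
elim/poly_ind: P => [|P c [IR II]].
  by split=> p; under eq_fun do rewrite horner0; exact: cvg_cst.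
have c1 p : (fun q : R * R => q.1) @ p --> p.1 by case: p => ? ?; exact: cvg_fst.
have c2 p : (fun q : R * R => q.2) @ p --> p.2 by case: p => ? ?; exact: cvg_snd.
split=> p.
  have -> : (fun p => Re (P * 'X + c%:P).[of_plane p]) =
     (fun p => Re P.[of_plane p] * p.1 - Im P.[of_plane p] * p.2 + Re c).
    apply/funext => q; rewrite hornerMXaddC.
    by case: P.[of_plane q] => a b; case: c {IR II} => c d.
  apply: cvgD; last exact: cvg_cst.
  apply: cvgB; apply: cvgM; first [exact: IR|exact: II|exact: c1|exact: c2].
have -> : (fun p => Im (P * 'X + c%:P).[of_plane p]) =
     (fun p => Re P.[of_plane p] * p.2 + Im P.[of_plane p] * p.1 + Im c).
  apply/funext => q; rewrite hornerMXaddC.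
  by case: P.[of_plane q] => a b; case: c {IR II} => c d.
apply: cvgD; last exact: cvg_cst.
apply: cvgD; apply: cvgM; first [exact: IR|exact: II|exact: c1|exact: c2].
Qed.

Lemma continuous_cabs_horner P : continuous (fun p => cabs P.[of_plane p]).
Proof. by have [cR cI] := continuous_horner_plane P; exact: continuous_cabs_comp. Qed.

Lemma continuous_cabs_dist w : continuous (fun p => cabs (of_plane p - w)).
Proof.
have := @continuous_cabs_horner ('X - w%:P).
by under eq_fun do rewrite hornerXsubC.
Qed.

Lemma ball_cabsP (A : set (R * R)) p : nbhs p A ->
  exists2 r : R, 0 < r & forall q, cabs (of_plane q - of_plane p) < r -> A q.
Proof.
move=> /nbhs_ballP[r r0 rA]; exists r => // q qp; apply: rA.
split; rewrite /ball/= distrC; apply: le_lt_trans qp.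
  by apply: le_trans (ge_Re_cabs _); case: q p => ? ? [].
by apply: le_trans (ge_Im_cabs _); case: q p => ? ? [].
Qed.

Lemma nbhs_cabs_lt w p (r : R) : cabs (of_plane p - w) < r ->
  \forall q \near p, cabs (of_plane q - w) < r.
Proof. by move=> pr; apply: (cvgr_lt _ (@continuous_cabs_dist w p)). Qed.

Lemma of_planeK (z : R[i]) : of_plane (Re z, Im z) = z.
Proof. by case: z. Qed.

Lemma compact_cabs_le (r : R) : compact [set p : R * R | cabs (of_plane p) <= r].
Proof.
have cl : closed [set p : R * R | cabs (of_plane p) <= r].
  apply: (closed_comp (f := fun p => cabs (of_plane p)) (D := [set x | x <= r])).
    move=> p _; have := @continuous_cabs_dist 0 p.
    by under eq_fun do rewrite subr0.
  exact: closed_le.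
apply: (subclosed_compact cl (B := `[- r, r] `*` `[- r, r])).
  by apply: compact_setX; exact: segment_compact.
move=> p /= pr; split => /=; rewrite in_itv/= -ler_norml; apply: le_trans pr.
  exact: (ge_Re_cabs (of_plane p)).
exact: (ge_Im_cabs (of_plane p)).
Qed.

End ComplexPlane.

(** * Logarithms of polynomials *)

Section LogHarmonic.
Context {R : realType}.
Implicit Types (z w y a : R[i]) (p q : R * R) (P : {poly R[i]}).

Lemma ln_dist1_le (w : R[i]) : cabs w <= 1 / 2 -> `|ln (cabs (1 - w))| <= 2 * cabs w.
Proof.
move=> w2; have w0 := cabs_ge0 w.
have h1 : cabs (1 - w) <= 1 + cabs w by have := cabsD 1 (- w); rewrite cabs1 cabsN.
have h2 : 1 - cabs w <= cabs (1 - w) by have := cabsB 1 w; rewrite cabs1.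
have h3 : 0 < cabs (1 - w) by lra.
rewrite ler_norml; apply/andP; split; last first.
  apply: le_trans (_ : ln (1 + cabs w) <= _); first by rewrite ler_ln// posrE; lra.
  apply: le_trans (le_ln1Dx _) _; lra.
apply: le_trans (_ : ln (1 - cabs w) <= _); last by rewrite ler_ln// posrE; lra.
(* The bound [ln (1 + x) <= x] at the inverse gives a lower bound; [cabs w <= 1 / 2] turns
   [cabs w / (1 - cabs w)] into [2 * cabs w]. *)
have -> : ln (1 - cabs w) = - ln (1 + ((1 - cabs w)^-1 - 1)).
  by rewrite [1 + (_ - 1)]addrC subrK lnV ?opprK// posrE; lra.
rewrite lerN2; apply: le_trans (le_ln1Dx _) _.
  have : 0 < (1 - cabs w)^-1 by rewrite invr_gt0; lra.
  lra.
rewrite lerBlDr -[_^-1]mul1r ler_pdivrMr; nra.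
Qed.

(* The product of the four shifts of [z] by [t], [-t], [i t], [-i t] is
   [z ^+ 4 - t ^+ 4]. *)
Lemma lap_ln_dist p a (d t : R) : 0 < d -> d <= cabs (of_plane p - a) -> 0 < t -> t <= d / 2 ->
  `|lap (fun q => ln (cabs (of_plane q - a))) p t| <= 2 / d ^+ 4 * t ^+ 4.
Proof.
move=> d0 da t0 td; set z := of_plane p - a in da *.
have z0 : z != 0 by rewrite -cabs_gt0; lra.
have e1 : of_plane (p.1 + t, p.2) - a = z + t%:C.
  by rewrite /z; case: p a {da z z0} => [x y] [b c]; apply/eqP; rewrite eq_complex /=; apply/andP; split; apply/eqP; ring.
have e2 : of_plane (p.1 - t, p.2) - a = z - t%:C.
  by rewrite /z; case: p a {da z z0 e1} => [x y] [b c]; apply/eqP; rewrite eq_complex /=; apply/andP; split; apply/eqP; ring.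
have e3 : of_plane (p.1, p.2 + t) - a = z + 'i%C * t%:C.
  by rewrite /z; case: p a {da z z0 e1 e2} => [x y] [b c]; apply/eqP; rewrite eq_complex /=; apply/andP; split; apply/eqP; ring.
have e4 : of_plane (p.1, p.2 - t) - a = z - 'i%C * t%:C.
  by rewrite /z; case: p a {da z z0 e1 e2 e3} => [x y] [b c]; apply/eqP; rewrite eq_complex /=; apply/andP; split; apply/eqP; ring.
have nz w : cabs w = t -> 0 < cabs (z + w).
  move=> wt; have := cabsB z (- w); rewrite opprK cabsN wt; lra.
have ct : cabs t%:C = t by rewrite cabs_real gtr0_norm.
have ci : cabs ('i%C : R[i]) = 1 by rewrite cabsE /= expr0n expr1n add0r sqrtr1.
have cit : cabs ('i%C * t%:C) = t by rewrite cabsM ct ci mul1r.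
have n1 := nz _ ct; have n3 := nz _ cit.
have n2 : 0 < cabs (z - t%:C) by apply: nz; rewrite cabsN.
have n4 : 0 < cabs (z - 'i%C * t%:C) by apply: nz; rewrite cabsN.
rewrite /lap e1 e2 e3 e4 -/z.
have zg : 0 < cabs z by rewrite cabs_gt0.
have E : (z + t%:C) * (z - t%:C) * (z + 'i%C * t%:C) * (z - 'i%C * t%:C) = z ^+ 4 * (1 - (t%:C / z) ^+ 4).
  have := sqr_i R; move: ('i%C : R[i]) (t%:C) z0 => i u z0 i2.
  have -> : (z + u) * (z - u) * (z + i * u) * (z - i * u)
    = (z ^+ 2 - u ^+ 2) * (z ^+ 2 - i ^+ 2 * u ^+ 2) by ring.
  by rewrite i2; field.
have q1 : cabs ((t%:C / z) ^+ 4) = (t / cabs z) ^+ 4 by rewrite cabsX cabsM cabsV ct.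
have tz : t / cabs z <= t / d by rewrite ler_wpM2l ?lef_pV2 ?posrE// ltW.
have tz0 : 0 <= t / cabs z by rewrite divr_ge0// ltW.
have q2 : (t / cabs z) ^+ 4 <= (t / d) ^+ 4 by rewrite lerXn2r ?nnegrE// divr_ge0// ltW.
have q3 : (t / d) ^+ 4 <= 1 / 2.
  have : t / d <= 1 / 2 by rewrite ler_pdivrMr//; lra.
  have : 0 <= t / d by rewrite divr_ge0// ltW.
  move: (t / d) => u u0 u1; apply: le_trans (_ : (1 / 2) ^+ 4 <= _); last lra.
  by rewrite lerXn2r ?nnegrE//; lra.
have n5 : 0 < cabs (1 - (t%:C / z) ^+ 4).
  have := cabsB 1 ((t%:C / z) ^+ 4); rewrite cabs1 q1; lra.
(* Subtracting [4 * ln (cabs z)] divides the product by [z ^+ 4]; what remains is within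
   [(t / d) ^+ 4] of 1. *)
have -> : ln (cabs (z + t%:C)) + ln (cabs (z - t%:C)) + ln (cabs (z + 'i%C * t%:C)) +
  ln (cabs (z - 'i%C * t%:C)) - 4 * ln (cabs z) = ln (cabs (1 - (t%:C / z) ^+ 4)).
  rewrite -!lnM ?posrE ?mulr_gt0// -!cabsM E cabsM cabsX lnM ?posrE ?exprn_gt0//.
  by rewrite lnXn// mulr_natl addrAC subrr add0r.
apply: le_trans (ln_dist1_le _) _; rewrite q1; first lra.
rewrite -mulrA ler_wpM2l//; apply: le_trans q2 _.
by rewrite expr_div_n mulrC.
Qed.

Lemma lap_sum (I : Type) (s : seq I) (F : I -> R * R -> R) p t :
  lap (fun q => \sum_(i <- s) F i q) p t = \sum_(i <- s) lap (F i) p t.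
Proof.
elim: s => [|i s IH]; first by rewrite /lap !big_nil; ring.
by rewrite big_cons -IH /lap !big_cons; ring.
Qed.

(** Factoring turns the logarithm into a constant plus one [ln] of a distance per root. The bound
    involves only the degree and the distance to the roots, so that it can be shared by a sequence
    of polynomials. *)
Lemma lap_ln_horner P p (d t : R) : P != 0 -> 0 < d ->
  (forall a, root P a -> d <= cabs (of_plane p - a)) -> 0 < t -> t <= d / 2 ->
  `|lap (fun q => ln (cabs P.[of_plane q])) p t| <= (size P).-1%:R * (2 / d ^+ 4 * t ^+ 4).
Proof.
move=> P0 d0 rd t0 td.
have [rs Prs] := closed_field_poly_normal P.
have lc0 : lead_coef P != 0 by rewrite lead_coef_eq0.
have srs : (size P).-1 = size rs.
  by rewrite Prs size_scale// size_prod_XsubC.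
have rrs a : a \in rs -> d <= cabs (of_plane p - a).
  by move=> ars; apply: rd; rewrite Prs rootZ// root_prod_XsubC.
pose G q := ln (cabs (lead_coef P)) + \sum_(a <- rs) ln (cabs (of_plane q - a)).
have EG q : (forall a, a \in rs -> of_plane q != a) -> ln (cabs P.[of_plane q]) = G q.
  move=> nq; rewrite /G {1}Prs hornerZ cabsM.
  have : 0 < cabs (\prod_(a <- rs) ('X - a%:P)).[of_plane q] /\
    ln (cabs (\prod_(a <- rs) ('X - a%:P)).[of_plane q]) = \sum_(a <- rs) ln (cabs (of_plane q - a)).
    elim: rs nq {Prs srs rrs G} => [|a s IH] nq.
      by rewrite !big_nil hornerC cabs1 ln1.
    have [|s0 sE] := IH; first by move=> b bs; apply: nq; rewrite inE bs orbT.
    have a0 : 0 < cabs (of_plane q - a) by rewrite cabs_gt0 subr_eq0 nq// inE eqxx.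
    rewrite !big_cons hornerM hornerXsubC cabsM lnM ?posrE// sE; split=> //.
    exact: mulr_gt0.
  have l0 : 0 < cabs (lead_coef P) by rewrite cabs_gt0.
  by case=> h1 h2; rewrite lnM ?posrE// h2.
(* At a root [ln 0] has a default value and the factored formula may fail; [t <= d / 2] keeps the
   five points away from the roots. *)
have far q : cabs (of_plane q - of_plane p) <= t -> ln (cabs P.[of_plane q]) = G q.
  move=> qt; apply: EG => a ars; apply/eqP => qa; have := rrs _ ars.
  by rewrite -qa cabs_distC; lra.
have -> : lap (fun q => ln (cabs P.[of_plane q])) p t = lap G p t.
  have ax (q : R * R) : `|q.1 - p.1| + `|q.2 - p.2| <= t -> cabs (of_plane q - of_plane p) <= t.
    exact: le_trans (cabs_plane_le _ _).
  have tn : `|t| = t by rewrite gtr0_norm.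
  rewrite /lap !far// ax//=.
  - by rewrite !subrr normr0 addr0 ltW.
  - by rewrite subrr normr0 add0r addrAC subrr add0r normrN tn.
  - by rewrite subrr normr0 add0r addrAC subrr add0r tn.
  - by rewrite subrr normr0 addr0 addrAC subrr add0r normrN tn.
  - by rewrite subrr normr0 addr0 addrAC subrr add0r tn.
have -> : lap G p t = \sum_(a <- rs) lap (fun q => ln (cabs (of_plane q - a))) p t.
  by rewrite -lap_sum /lap /G; ring.
apply: le_trans (ler_norm_sum _ _ _) _.
have -> : (size P).-1%:R * (2 / d ^+ 4 * t ^+ 4) = \sum_(a <- rs) (2 / d ^+ 4 * t ^+ 4).
  by rewrite srs big_const_seq count_predT iter_addr_0 mulr_natl.
rewrite !big_seq; apply: ler_sum => a ars; apply: lap_ln_dist => //; exact: rrs.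
Qed.

End LogHarmonic.

(** * Green's functions of polynomial preimages of [-1, 1] *)

Section SegmentGreen.
Context {R : realType}.
Implicit Types (z w y : R[i]) (p q : R * R) (P T : {poly R[i]}).

Definition foci_mean y : R := (cabs (y - 1) + cabs (y + 1)) / 2.

(* The Green's function of the complement of [-1, 1]; the level sets of
   [foci_mean] are the ellipses with foci -1 and 1. *)
Definition green_seg y : R :=
  ln (foci_mean y + Num.sqrt (foci_mean y ^+ 2 - 1)).

(* The two roots [z] of [z ^+ 2 - 2 * y * z + 1] have product 1; take the one of
   modulus at least 1. *)
Lemma joukowskiP y : exists z, [/\ z != 0, y = (z + z^-1) / 2, 1 <= cabs z,
  foci_mean y = (cabs z + (cabs z)^-1) / 2 & green_seg y = ln (cabs z)].
Proof.
have [z [z0 yz z1]] : exists z, [/\ z != 0, y = (z + z^-1) / 2 & 1 <= cabs z].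
  pose s := sqrtc (y ^+ 2 - 1).
  have s2 : s ^+ 2 = y ^+ 2 - 1 by exact: sqr_sqrtc.
  have prod1 : (y + s) * (y - s) = 1.
    by have -> : (y + s) * (y - s) = y ^+ 2 - s ^+ 2 by [ring]; rewrite s2; ring.
  have p0 : y + s != 0.
    by apply/eqP => h; move: prod1; rewrite h mul0r => /eqP; rewrite eq_sym oner_eq0.
  have iE : (y + s)^-1 = y - s.
    by apply: (mulfI p0); rewrite mulfV// prod1.
  have [h|h] := leP 1 (cabs (y + s)).
    by exists (y + s); split => //; rewrite iE; field.
  exists (y - s); rewrite -iE invr_eq0 invrK iE; split => //; first by field.
  rewrite -iE cabsV -[1]invr1 lef_pV2 ?posrE ?ltr01 ?cabs_gt0//; exact: ltW.
have r0 : 0 < cabs z by lra.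
have fE : foci_mean y = (cabs z + (cabs z)^-1) / 2.
  (* The numerators being squares, [foci_mean y] is [(|z - 1| ^ 2 + |z + 1| ^ 2) / (4 |z|)], which
     the parallelogram law evaluates. *)
  have e1 : y - 1 = (z - 1) ^+ 2 / (2 * z) by rewrite yz; field.
  have e2 : y + 1 = (z + 1) ^+ 2 / (2 * z) by rewrite yz; field.
  have c2 : cabs (2 : R[i]) = 2.
    have -> : (2 : R[i]) = (2 : R)%:C by rewrite rmorph_nat.
    by rewrite cabs_real ger0_norm.
  have sq : cabs z ^+ 2 = Re z ^+ 2 + Im z ^+ 2 by exact: sqr_cabs.
  have cs u : cabs (u ^+ 2 / (2 * z)) = cabs u ^+ 2 / (2 * cabs z).
    by rewrite cabsM cabsX cabsV cabsM c2.
  rewrite /foci_mean e1 e2 !cs (sqr_cabs (z - 1)) (sqr_cabs (z + 1)).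
  have -> : Re (z - 1) ^+ 2 + Im (z - 1) ^+ 2 = cabs z ^+ 2 + 1 - 2 * Re z.
    by rewrite sq; case: (z) => a b /=; ring.
  have -> : Re (z + 1) ^+ 2 + Im (z + 1) ^+ 2 = cabs z ^+ 2 + 1 + 2 * Re z.
    by rewrite sq; case: (z) => a b /=; ring.
  by field; rewrite gt_eqF.
exists z; split => //; rewrite /green_seg fE; congr ln.
have -> : ((cabs z + (cabs z)^-1) / 2) ^+ 2 - 1 = ((cabs z - (cabs z)^-1) / 2) ^+ 2.
  by field; rewrite gt_eqF.
rewrite sqrtr_sqr ger0_norm; first by field; rewrite gt_eqF.
by rewrite divr_ge0// subr_ge0; apply: le_trans (z1); rewrite invf_le1.
Qed.

Lemma green_seg_ge0 y : 0 <= green_seg y.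
Proof. by have [z [_ _ z1 _ ->]] := joukowskiP y; rewrite ln_ge0. Qed.

Lemma cosh_green_seg y : (expR (green_seg y) + expR (- green_seg y)) / 2 = foci_mean y.
Proof.
have [z [_ _ z1 -> ->]] := joukowskiP y.
by rewrite expRN lnK// posrE; lra.
Qed.

Lemma foci_mean_real (t : R) : 1 <= `|t| -> foci_mean t%:C = `|t|.
Proof.
rewrite /foci_mean -(rmorph1 (real_complex R)) -rmorphB -rmorphD !cabs_real.
have [t0|t0] := leP 0 t.
  by rewrite (ger0_norm t0) => t1; rewrite !ger0_norm; lra.
by rewrite (ltr0_norm t0) => t1; rewrite !ler0_norm; lra.
Qed.

(** The value is [ln |z|] with [y = (z + z^-1) / 2]. It vanishes on the unit circle, where [z^-1] is
    the conjugate of [z] and [y] is therefore the real part of [z]. *)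
Lemma green_seg_eq0 y :
  green_seg y = 0 <-> exists2 t : R, -1 <= t <= 1 & y = t%:C.
Proof.
split=> [|[t /andP[t1 t2] ->]]; last first.
  have f1 : foci_mean t%:C = 1.
    rewrite /foci_mean -(rmorph1 (real_complex R)) -rmorphB -rmorphD !cabs_real.
    by rewrite ler0_norm ?ger0_norm; lra.
  by rewrite /green_seg f1 expr1n subrr sqrtr0 addr0 ln1.
have [z [z0 -> z1 _ ->]] := joukowskiP y => /eqP.
rewrite ln_eq0; last lra.
move=> /eqP cz; exists (Re z).
  by rewrite -ler_norml; apply: le_trans (ge_Re_cabs _) _; rewrite cz.
have sq : Re z ^+ 2 + Im z ^+ 2 = 1 by rewrite -sqr_cabs cz expr1n.
have -> : z^-1 = z^*%C.
  apply: (mulfI z0); rewrite mulfV//; case: (z) sq => a b /= sq.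
  by apply/eqP; rewrite eq_complex/=; apply/andP; split; apply/eqP; first rewrite -sq; ring.
by rewrite addcJ mulrC mulKf// pnatr_eq0.
Qed.

(** The constant 3 comes from [z = 2 * y - z^-1] with [|z^-1| <= 1 <= |y|]. *)
Lemma green_seg_bounds y : 1 <= cabs y ->
  ln (cabs y) <= green_seg y <= ln (3 * cabs y).
Proof.
move=> y1; have [z [z0 yz z1 _ ->]] := joukowskiP y.
have c2 : cabs (2 : R[i]) = 2.
  have -> : (2 : R[i]) = (2 : R)%:C by rewrite rmorph_nat.
  by rewrite cabs_real ger0_norm.
have i1 : (cabs z)^-1 <= 1 by rewrite invf_le1//; lra.
have h1 : cabs y <= cabs z.
  rewrite yz cabsM cabsV c2 ler_pdivrMr//; apply: le_trans (cabsD _ _) _.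
  by rewrite cabsV; lra.
have h2 : cabs z <= 3 * cabs y.
  have -> : z = 2 * y - z^-1 by rewrite yz; field.
  apply: le_trans (cabsD _ _) _; rewrite cabsN cabsM c2 cabsV; lra.
by rewrite !ler_ln ?posrE ?h1//; lra.
Qed.

Definition green_poly T p : R := green_seg T.[of_plane p].

Lemma green_poly_continuous T : continuous (green_poly T).
Proof.
have cf : continuous (fun p => foci_mean T.[of_plane p]).
  have -> : (fun p => foci_mean T.[of_plane p]) =
      (fun p => (cabs (T - 1%:P).[of_plane p] + cabs (T + 1%:P).[of_plane p]) * 2^-1).
    by apply/funext => p; rewrite /foci_mean !hornerE.
  move=> p; apply: cvgM; last exact: cvg_cst.
  by apply: cvgD; exact: continuous_cabs_horner.
have cg : continuous (fun p => foci_mean T.[of_plane p] +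
    Num.sqrt (foci_mean T.[of_plane p] ^+ 2 - 1)).
  move=> p; apply: cvgD; first exact: cf.
  apply: (@continuous_comp _ _ _ (fun p => foci_mean T.[of_plane p] ^+ 2 - 1) Num.sqrt); last exact: sqrt_continuous.
  apply: cvgB; last exact: cvg_cst.
  by under eq_fun do rewrite expr2; apply: cvgM; exact: cf.
move=> p.
apply: (@continuous_comp _ _ _ (fun p => foci_mean T.[of_plane p] +
    Num.sqrt (foci_mean T.[of_plane p] ^+ 2 - 1)) (@ln R)); first exact: cg.
apply: continuous_ln; have [z [_ _ z1 -> _]] := joukowskiP T.[of_plane p].
apply: ltr_pwDl; last exact: sqrtr_ge0.
by rewrite divr_gt0// addr_gt0// ?invr_gt0; lra.
Qed.

(* The composition of [T] with the Chebyshev polynomial of degree [2 ^ k]. *)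
Fixpoint doubling T k : {poly R[i]} :=
  if k is k'.+1 then 2 *: doubling T k' ^+ 2 - 1 else T.

Lemma size_doubling T k n : (0 < n)%N -> size T = n.+1 ->
  size (doubling T k) = (n * 2 ^ k).+1.
Proof.
move=> n0 sT; elim: k => [|k IH] /=; first by rewrite expn0 muln1.
have s2 : size (2 *: doubling T k ^+ 2) = (n * 2 ^ k.+1).+1.
  rewrite size_scale ?pnatr_eq0// expr2 size_mul -?size_poly_eq0 ?IH//.
  by rewrite expnS; lia.
rewrite size_polyDl// s2 size_polyN size_poly1 ltnS muln_gt0 n0 expn_gt0//.
Qed.

(** The map [y => 2 * y ^+ 2 - 1] squares the Joukowski coordinate: it sends [(u + u^-1) / 2] to
    [(u ^+ 2 + u ^- 2) / 2]. *)
Lemma horner_doubling T k z w : z != 0 -> T.[w] = (z + z^-1) / 2 ->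
  (doubling T k).[w] = (z ^+ (2 ^ k) + (z ^+ (2 ^ k))^-1) / 2.
Proof.
move=> z0 Tw; elim: k => [|k IH] /=; first by rewrite expn0 expr1.
rewrite hornerD hornerN hornerC hornerZ horner_exp IH expnS mulnC exprM.
have : z ^+ (2 ^ k) != 0 by rewrite expf_neq0.
by move: (z ^+ _) => u u0; field.
Qed.

(** A zero means [u ^+ 2 = -1] for [u = z ^+ (2 ^ k)], which puts [z] on the unit circle. *)
Lemma root_doubling T k w : root (doubling T k) w -> green_seg T.[w] = 0.
Proof.
have [z [z0 Tw z1 _ ->]] := joukowskiP T.[w].
rewrite /root (horner_doubling k z0 Tw) => /eqP.
have := expf_neq0 (2 ^ k)%N z0; move uE: (z ^+ _) => u u0 h.
have u2 : u ^+ 2 = -1.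
  have -> : u ^+ 2 = 2 * u * ((u + u^-1) / 2) - 1 by field.
  by rewrite h; ring.
have : cabs u ^+ 2 == 1 by rewrite -cabsX u2 cabsN cabs1.
rewrite sqrp_eq1 ?cabs_ge0// -uE cabsX => /eqP h1.
have : cabs z == 1 by rewrite -(@pexpr_eq1 _ _ (2 ^ k)) ?expn_gt0 ?cabs_ge0// h1.
by move/eqP => ->; rewrite ln1.
Qed.

Lemma cvg_ln_doubling T w : 0 < green_seg T.[w] ->
  (fun k => (2 ^+ k)^-1 * ln (cabs (doubling T k).[w])) @ \oo --> green_seg T.[w].
Proof.
have [z [z0 Tw z1 _ ->]] := joukowskiP T.[w] => lz.
have z1' : 1 < cabs z.
  by rewrite lt_def z1 andbT; apply/eqP => h; move: lz; rewrite h ln1 ltxx.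
have c2 : cabs (2 : R[i]) = 2.
  have -> : (2 : R[i]) = (2 : R)%:C by rewrite rmorph_nat.
  by rewrite cabs_real ger0_norm.
have [k0 hk0] : exists k0, forall k, (k0 <= k)%N -> 2 <= cabs z ^+ (2 ^ k).
  have [m hm] : exists m, 1 / (cabs z - 1) < m%:R.
    by exists (Num.bound (1 / (cabs z - 1))); apply: archi_boundP; rewrite divr_ge0//; lra.
  exists m => k mk.
  have : m%:R <= (2 ^ k)%:R :> R.
    by rewrite ler_nat (leq_trans mk)// ltnW// ltn_expl.
  move: (2 ^ k)%N => N mN; have hN : 1 < N%:R * (cabs z - 1).
    by rewrite -ltr_pdivrMr ?subr_gt0//; exact: lt_le_trans hm mN.
  (* Bernoulli's inequality; [m] was chosen so that the left-hand side exceeds 2. *)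
  have : 1 + N%:R * (cabs z - 1) <= cabs z ^+ N.
    elim: N {mN hN} => [|N IH]; first by rewrite mul0r expr0 addr0.
    rewrite exprS -natr1; have := ler_wpM2l (cabs_ge0 z) IH.
    have := mulr_ge0 (ler0n R N) (sqr_ge0 (cabs z - 1)); lra.
  lra.
(* Once [u = |z| ^ (2 ^ k)] is at least 2, the modulus of [doubling T k] at [w] lies between [u / 4]
   and [u]; the factor 4 costs [ln 4 / 2 ^ k]. *)
apply: (@squeeze_cvgr _ _ _ _ (fun k => ln (cabs z) - ln 4 * (2^-1) ^+ k) (fun=> ln (cabs z))).
- exists k0 => // k /= kk0.
  have hz := hk0 _ kk0.
  have zk0 := expf_neq0 (2 ^ k)%N z0.
  rewrite (horner_doubling k z0 Tw) cabsM cabsV c2.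
  have h1 := cabsD (z ^+ (2 ^ k)) (z ^+ (2 ^ k))^-1.
  have h2 := cabsB (z ^+ (2 ^ k)) (- (z ^+ (2 ^ k))^-1).
  move: h1 h2; rewrite opprK cabsN cabsV cabsX.
  have N0 : (0 : R) < 2 ^+ k by rewrite exprn_gt0.
  have lnE : ln (cabs z) = (2 ^+ k)^-1 * ln (cabs z ^+ (2 ^ k)).
    rewrite lnXn; last lra.
    by rewrite -(mulr_natl (ln _)) natrX mulrA mulVf ?mul1r// gt_eqF.
  rewrite exprVn lnE; move: (cabs z ^+ _) hz => u u2 h1 h2.
  have ui : u^-1 <= 1 / 2.
    by rewrite mul1r lef_pV2 ?posrE//; lra.
  set c := cabs (_ + _) in h1 h2 *.
  have c0 : 0 < c / 2 by rewrite divr_gt0//; lra.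
  rewrite (mulrC (ln 4)) -mulrBr !ler_pM2l ?invr_gt0//.
  rewrite -ln_div ?posrE//; last lra.
  by rewrite !ler_ln ?posrE//; try lra; apply/andP; split; lra.
- rewrite -[X in _ --> X]subr0 -[X in _ --> _ - X](mulr0 (ln 4)).
  apply: cvgB; first exact: cvg_cst.
  apply: cvgM; first exact: cvg_cst.
  by apply: cvg_expr; rewrite ger0_norm ?invr_ge0// invf_lt1// ltr1n.
- exact: cvg_cst.
Qed.

Lemma lap_cvg (F : nat -> R * R -> R) (G : R * R -> R) p t (B : R) :
  (forall q, cabs (of_plane q - of_plane p) <= t -> F ^~ q @ \oo --> G q) -> 0 < t ->
  (forall k, `|lap (F k) p t| <= B) -> `|lap G p t| <= B.
Proof.
move=> FG t0 FB.
have ax (q : R * R) : `|q.1 - p.1| + `|q.2 - p.2| <= t -> F ^~ q @ \oo --> G q.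
  move=> h; apply: FG; apply: le_trans h; exact: cabs_plane_le.
have tn : `|t| = t by rewrite gtr0_norm.
have cl : (fun k => `|lap (F k) p t|) @ \oo --> `|lap G p t|.
  apply: cvg_norm; rewrite /lap; apply: cvgB; last first.
    by apply: cvgM; [exact: cvg_cst|apply: ax; rewrite !subrr normr0 addr0 ltW].
  apply: cvgD; first apply: cvgD; first apply: cvgD; apply: ax => /=.
  - by rewrite subrr normr0 addr0 addrAC subrr add0r tn.
  - by rewrite subrr normr0 addr0 addrAC subrr add0r normrN tn.
  - by rewrite subrr normr0 add0r addrAC subrr add0r tn.
  - by rewrite subrr normr0 add0r addrAC subrr add0r normrN tn.
by apply: (cvgr_to_le cl); exists 0%N => // k _; exact: FB.
Qed.

End SegmentGreen.

Section PolynomialGreen.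
Context {R : realType}.
Implicit Types (z w y : R[i]) (p q : R * R) (P T : {poly R[i]}).

Lemma lapZ (k : R) (f : R * R -> R) p t : lap (fun q => k * f q) p t = k * lap f p t.
Proof. by rewrite /lap; ring. Qed.

Lemma lapN (f : R * R -> R) p t : lap (fun q => - f q) p t = - lap f p t.
Proof. by rewrite /lap; ring. Qed.

(* [green_poly T] is the limit of [2 ^- k * ln |doubling T k|], and the roots of
   all the [doubling T k] lie where it vanishes, hence far from [p]; this bounds
   the discrete Laplacians uniformly in [k]. *)
Lemma lap_green_poly T n p : (0 < n)%N -> size T = n.+1 -> 0 < green_poly T p ->
  exists d B : R, [/\ 0 < d, 0 <= B &
    forall t, 0 < t -> t <= d -> `|lap (green_poly T) p t| <= B * t ^+ 4].
Proof.
move=> n0 sT vp.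
have [r r0 rv] := ball_cabsP (cvgr_gt _ (@green_poly_continuous R T p) _ vp).
(* The degree [n * 2 ^ k] of [doubling T k] cancels the factor [2 ^- k], leaving a constant free of
   [k]. *)
exists (r / 2 / 2), (n%:R * (2 / r ^+ 4)); split.
- by rewrite !divr_gt0.
- by rewrite mulr_ge0// divr_ge0// exprn_ge0// ltW.
move=> t t0 td.
apply: (@lap_cvg R (fun k q => (2 ^+ k)^-1 * ln (cabs (doubling T k).[of_plane q]))) => //.
  by move=> q qp; apply: cvg_ln_doubling; apply: rv; lra.
move=> k; have sD := size_doubling k n0 sT.
rewrite lapZ normrM gtr0_norm ?invr_gt0 ?exprn_gt0//.
have := @lap_ln_horner R (doubling T k) p r t _ r0 _ t0.
rewrite -size_poly_gt0 sD /= => /(_ isT) h.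
rewrite -ler_pdivlMl ?invr_gt0 ?exprn_gt0// invrK.
apply: le_trans (h _ _) _; last 2 first.
- lra.
- by rewrite natrM natrX !mulrA (mulrC n%:R).
move=> a /root_doubling ra; rewrite leNgt; apply/negP => ar.
have := rv (Re a, Im a); rewrite of_planeK cabs_distC => /(_ ar).
by rewrite /green_poly of_planeK ra ltxx.
Qed.

Lemma superharm_lap_bound (f : R * R -> R) p (d B : R) : 0 < d -> 0 <= B ->
  (forall t, 0 < t -> t <= d -> lap f p t <= B * t ^+ 4) -> superharm f p.
Proof.
move=> d0 B0 fB e e0; near=> t.
have t0 : 0 < t by near: t; exact: nbhs_right_gt.
have td : t <= d by near: t; exact: nbhs_right_le.
have t1 : t <= 1 by near: t; exact: nbhs_right_le.
have te : t <= e / (B + 1) by near: t; apply: nbhs_right_le; rewrite divr_gt0//; lra.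
apply: le_trans (fB _ t0 td) _.
have -> : B * t ^+ 4 = B * t ^+ 2 * t ^+ 2 by ring.
rewrite ler_wpM2r ?sqr_ge0//.
apply: le_trans (_ : B * t <= _).
  by rewrite ler_wpM2l// -[leRHS]mulr1 expr2 ler_wpM2l// ltW.
move: te; rewrite ler_pdivlMr; last lra.
nra.
Unshelve. all: by end_near. Qed.

Lemma superharm_green_poly T n p : (0 < n)%N -> size T = n.+1 ->
  0 < green_poly T p -> superharm (green_poly T) p.
Proof.
move=> n0 sT vp; have [d [B [d0 B0 h]]] := lap_green_poly n0 sT vp.
apply: (superharm_lap_bound d0 B0) => t t0 td.
exact: le_trans (ler_norm _) (h _ t0 td).
Qed.

(** At a zero the nonnegative function [green_poly T] has a minimum, so its discrete Laplacian is
    nonnegative for every step; elsewhere the two-sided bound of [lap_green_poly] applies. *)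
Lemma subharm_green_poly T n p : (0 < n)%N -> size T = n.+1 ->
  superharm (fun q => - green_poly T q) p.
Proof.
move=> n0 sT; have [v0|vp] := eqVneq (green_poly T p) 0.
  apply: (@superharm_lap_bound _ _ 1 0) => // t _ _.
  rewrite mul0r lapN /lap v0.
  have h q : 0 <= green_poly T q by exact: green_seg_ge0.
  by rewrite mulr0 subr0 oppr_le0 !addr_ge0.
have {}vp : 0 < green_poly T p by rewrite lt_def vp green_seg_ge0.
have [d [B [d0 B0 h]]] := lap_green_poly n0 sT vp.
apply: (superharm_lap_bound d0 B0) => t t0 td; rewrite lapN.
by apply: le_trans (h _ t0 td); rewrite -normrN ler_norm.
Qed.

(** * Growth at infinity, boundary values and comparison *)

Definition log_growth (n : nat) (u : R * R -> R) := exists A r : R,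
  0 < r /\ forall p, r <= cabs (of_plane p) ->
    `|u p - n%:R * ln (cabs (of_plane p))| <= A.

(** Convergence to 0 at [K], phrased with a closed set [F] off [K]: cut by a large disc, [F] gives
    the compact sets that [min_principle] requires. *)
Definition vanishes_at (K : set (R * R)) (u : R * R -> R) :=
  forall e : R, 0 < e -> exists F : set (R * R), [/\ closed F, F `<=` ~` K &
    forall p, ~ K p -> ~ F p -> `|u p| <= e].

Lemma prod_XsubC_bounds (rs : seq R[i]) w : (forall a, a \in rs -> 2 * cabs a <= cabs w) ->
  (cabs w / 2) ^+ size rs <= cabs (\prod_(a <- rs) ('X - a%:P)).[w] <= (2 * cabs w) ^+ size rs.
Proof.
have w0 := cabs_ge0 w.
elim: rs => [|a s IH] sw; first by rewrite big_nil hornerC cabs1 !expr0 lexx.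
have /andP[h1 h2] := IH (fun b bs => sw b (mem_behead (s := a :: s) bs)).
have a2 := sw a (mem_head _ _); have a0 := cabs_ge0 a.
rewrite big_cons hornerM hornerXsubC cabsM /= !exprS.
have g1 := cabsB w a; have g2 := cabsD w (- a); rewrite cabsN in g2.
apply/andP; split; apply: ler_pM => //; rewrite ?exprn_ge0 ?cabs_ge0//; lra.
Qed.

Lemma horner_growth T n : (0 < n)%N -> size T = n.+1 -> exists A r : R,
  0 < r /\ forall w, r <= cabs w ->
   1 <= cabs T.[w] /\ `|ln (cabs T.[w]) - n%:R * ln (cabs w)| <= A.
Proof.
move=> n0 sT; have T0 : T != 0 by rewrite -size_poly_gt0 sT.
have [rs Trs] := closed_field_poly_normal T.
have srs : size rs = n.
  have : size T = (size rs).+1.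
    by rewrite Trs size_scale ?lead_coef_eq0// size_prod_XsubC.
  by rewrite sT => -[].
set c := cabs (lead_coef T).
have c0 : 0 < c by rewrite cabs_gt0 lead_coef_eq0.
pose M := \sum_(a <- rs) cabs a.
have Mr a : a \in rs -> cabs a <= M.
  by move=> ars; rewrite /M (big_rem a)//= lerDl sumr_ge0// => ? _; exact: cabs_ge0.
have M0 : 0 <= M by rewrite sumr_ge0// => ? _; exact: cabs_ge0.
(* Beyond [2 * M] each factor [|w - a|] lies between [|w| / 2] and [2 * |w|]. The terms [2] and
   [2 / c] ensure [1 / c <= |w| / 2 <= (|w| / 2) ^ n], hence a value of modulus at least 1. *)
exists (`|ln c| + n%:R * ln 2), (2 * M + 2 + 2 / c); split.
  by have : 0 < 2 / c by [rewrite divr_gt0]; lra.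
move=> w rw.
have c2 : 0 < 2 / c by rewrite divr_gt0.
have w2 : 2 <= cabs w by lra.
have /andP[b1 b2] : (cabs w / 2) ^+ n <= cabs (\prod_(a <- rs) ('X - a%:P)).[w] <= (2 * cabs w) ^+ n.
  by rewrite -srs; apply: prod_XsubC_bounds => a /Mr; lra.
rewrite Trs hornerZ cabsM -/c.
have p1 : 0 < (cabs w / 2) ^+ n by rewrite exprn_gt0//; lra.
have p2 : 0 < (2 * cabs w) ^+ n by rewrite exprn_gt0//; lra.
move: b1 b2; move: (cabs _.[w]) => b b1 b2.
have b0 : 0 < b by lra.
split.
  have h : 1 / c <= (cabs w / 2) ^+ n.
    apply: le_trans (_ : cabs w / 2 <= _); first lra.
    by rewrite -[leLHS]expr1 ler_weXn2l//; lra.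
  by move: h; rewrite ler_pdivrMr//; nra.
have l1 : n%:R * (ln (cabs w) - ln 2) <= ln b.
  rewrite -ln_div ?posrE//; last lra.
  by rewrite mulr_natl -lnXn ?ler_ln ?posrE//; lra.
have l2 : ln b <= n%:R * (ln (cabs w) + ln 2).
  rewrite -lnM ?posrE//; last lra.
  by rewrite mulr_natl -lnXn ?ler_ln ?posrE ?(mulrC (cabs w))//; lra.
rewrite lnM ?posrE// ler_norml; have := ler_norm (ln c); have := ler_norm (- ln c).
by rewrite normrN => *; apply/andP; split; lra.
Qed.

Lemma log_growth_green_poly T n : (0 < n)%N -> size T = n.+1 ->
  log_growth n (green_poly T).
Proof.
move=> n0 /(horner_growth n0)[A [r [r0 h]]]; exists (A + ln 3), r; split=> // p rp.
have [T1 /ler_normlP[h1 h2]] := h _ rp.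
have /andP[] := green_seg_bounds T1; rewrite lnM ?posrE//; last lra.
rewrite -/(green_poly T p) => g1 g2.
have l3 : 0 <= ln (3 : R) by rewrite ln_ge0// ler1n.
by rewrite ler_norml; apply/andP; split; lra.
Qed.

Lemma vanishes_at_green_poly T (K : set (R * R)) :
  (forall p, K p -> green_poly T p = 0) -> vanishes_at K (green_poly T).
Proof.
move=> K0 e e0; exists [set p | e <= green_poly T p]; split.
- apply: (closed_comp (f := green_poly T) (D := [set x | e <= x])).
    by move=> p _; exact: green_poly_continuous.
  exact: closed_ge.
- by move=> p /= ep /K0 vp; move: ep; rewrite vp leNgt e0.
- move=> p _ /= /negP; rewrite -ltNge => pe.
  by rewrite ger0_norm ?green_seg_ge0// ltW.
Qed.

(** In the chart [w = z^-1] the difference [g - ln |z|] extends continuously to 0, so it is bounded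
    by [|h 0| + 1] near infinity. *)
Lemma green_log_growth (K : set R[i]) g : is_green K g ->
  log_growth 1 (fun p => g (of_plane p)).
Proof.
case=> _ [r [h [r0 hh hE]]] _.
have oB : open (@of_plane R @^-1` [set w | cabs w < r]).
  rewrite openE => p pr.
  have pr' : cabs (of_plane p - 0) < r by rewrite subr0.
  by apply: filterS (nbhs_cabs_lt pr') => q; rewrite subr0.
have o0 : of_plane (0, 0) = 0 :> R[i] by [].
have ch : {for ((0, 0) : R * R), continuous (fun q => h (of_plane q))}.
  by apply: (harmonic_on_continuous oB hh); rewrite o0 /mkset cabs0.
have [s s0 hs] : exists2 s : R, 0 < s & forall q, cabs (of_plane q) < s -> `|h (of_plane q) - h 0| < 1.
  have : \forall q \near ((0, 0) : R * R), `|h 0 - h (of_plane q)| < 1.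
    by move/cvgrPdist_lt : ch => /(_ 1 ltr01).
  move=> /ball_cabsP[s s0 hs]; exists s => // q qs; rewrite distrC; apply: hs.
  by rewrite o0 subr0.
pose m := Num.min r s; have m0 : 0 < m by rewrite lt_min r0.
exists (`|h 0| + 1), (m^-1 + 1); split; first by have : 0 < m^-1 by [rewrite invr_gt0]; lra.
move=> p pm; rewrite mul1r.
have cp : 0 < cabs (of_plane p) by have : 0 < m^-1 by [rewrite invr_gt0]; lra.
have im : cabs (of_plane p)^-1 < m.
  by rewrite cabsV -[m]invrK ltf_pV2 ?posrE ?invr_gt0//; lra.
have := hE (of_plane p)^-1; rewrite invrK.
move: (im); rewrite lt_min => /andP[ir is_].
rewrite ir cabsV invr_gt0 cp => /(_ isT) <-.
have := hs (Re (of_plane p)^-1, Im (of_plane p)^-1); rewrite of_planeK => /(_ is_).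
have := ler_normD (h (of_plane p)^-1 - h 0) (h 0); rewrite subrK; lra.
Qed.

Lemma vanishes_at_green (K : set R[i]) g : is_green K g ->
  vanishes_at (@of_plane R @^-1` K) (fun p => g (of_plane p)).
Proof.
case=> _ _ gK e e0; have [d d0 hd] := gK _ e0.
exists (\bigcap_(k in K) [set p | d <= cabs (of_plane p - k)]); split.
- apply: closed_bigI => k Kk.
  apply: (closed_comp (f := fun p => cabs (of_plane p - k)) (D := [set x | d <= x])).
    by move=> p _; exact: continuous_cabs_dist.
  exact: closed_ge.
- move=> p Fp Kp; have : d <= cabs (of_plane p - of_plane p) := Fp _ Kp.
  by rewrite subrr cabs0; lra.
- move=> p Kp Fp; apply/ltW/hd => //.
  apply: contrapT => h; apply: Fp => k Kk /=; rewrite leNgt; apply/negP => kd.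
  by apply: h; exists k.
Qed.

Lemma vanishes_atZ (K : set (R * R)) u (k : R) : vanishes_at K u ->
  vanishes_at K (fun p => k * u p).
Proof.
move=> h e e0; have k0 : 0 < `|k| + 1 by have := normr_ge0 k; lra.
have [|F [cF FK hF]] := h (e / (`|k| + 1)); first by rewrite divr_gt0.
exists F; split => // p Kp Fp; rewrite normrM.
apply: le_trans (ler_wpM2l (normr_ge0 k) (hF _ Kp Fp)) _.
rewrite mulrA ler_pdivrMr//; nra.
Qed.

Lemma log_growthZ u n : log_growth 1 u -> log_growth n (fun p => n%:R * u p).
Proof.
case=> A [r [r0 h]]; exists (n%:R * A), r; split=> // p /h; rewrite mul1r => hp.
by rewrite -mulrBr normrM ger0_norm// ler_wpM2l.
Qed.

(* Scaling [v] by [1 - e] makes [u - (1 - e) v] tend to [+oo] at infinity, so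
   that only the behaviour near [K] matters. *)
Lemma log_growth_comparison (K : set (R * R)) (n m : nat) (u v : R * R -> R) :
  open (~` K) -> (0 < n)%N -> (m <= n)%N ->
  (forall p, ~ K p -> {for p, continuous u}) ->
  (forall p, ~ K p -> {for p, continuous v}) ->
  (forall p, ~ K p -> superharm u p) ->
  (forall p, ~ K p -> superharm (fun q => - v q) p) ->
  vanishes_at K u -> vanishes_at K v -> log_growth n u -> log_growth m v ->
  forall p, ~ K p -> v p <= u p.
Proof.
move=> oK n0 mn cu cv su sv vu vv [A1 [r1 [r10 gu]]] [A2 [r2 [r20 gv]]].
have key (e : R) : 0 < e -> e < 1 -> forall p, ~ K p -> 0 <= u p + (1 - e) * - v p.
  move=> e0 e1; apply: min_principle => // [p Kp|p Kp|d d0].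
  - apply: cvgD; first exact: cu.
    by apply: cvgM; [exact: cvg_cst|apply: cvgN; exact: cv].
  - apply: superharmD; first exact: su.
    by apply: superharmZ; [lra|exact: sv].
  have d20 : 0 < d / 2 by rewrite divr_gt0.
  have [F1 [cF1 F1K hF1]] := vu _ d20; have [F2 [cF2 F2K hF2]] := vv _ d20.
  (* Where [ln |z| >= B], the gain [e * n * ln |z|] outweighs both growth constants. *)
  pose B := (`|A1| + `|A2|) / e; pose r := r1 + r2 + expR B.
  have B0 : 0 <= B by rewrite divr_ge0 ?addr_ge0// ltW.
  exists ((F1 `|` F2) `&` [set p | cabs (of_plane p) <= r]).
    by rewrite setIC; apply: compact_closedI; [exact: compact_cabs_le|exact: closedU].
  split=> [p [[/F1K|/F2K]//]|p Kp /not_andP[/not_orP[f1 f2]|/negP]].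
    have /ler_normlP[a1 a2] := hF1 _ Kp f1; have /ler_normlP[b1 b2] := hF2 _ Kp f2.
    have : - (d / 2) <= (1 - e) * - v p.
      have : (1 - e) * - v p >= (1 - e) * - (d / 2) by rewrite ler_wpM2l; lra.
      nra.
    lra.
  rewrite -ltNge => rp.
  have eB := expR_gt0 B.
  have /ler_normlP[a1 _] : `|u p - n%:R * ln (cabs (of_plane p))| <= A1.
    by apply: gu; rewrite /r in rp; lra.
  have /ler_normlP[_ b1] : `|v p - m%:R * ln (cabs (of_plane p))| <= A2.
    by apply: gv; rewrite /r in rp; lra.
  have lB : B <= ln (cabs (of_plane p)).
    by rewrite -[B]expRK ler_ln ?posrE//; rewrite /r in rp; lra.
  move: a1 b1 lB; move: (ln _) => L a1 b1 BL.
  have L0 : 0 <= L by exact: le_trans BL.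
  have eL : `|A1| + `|A2| <= e * L by move: BL; rewrite /B ler_pdivrMr// mulrC.
  have n1 : (1 : R) <= n%:R by rewrite ler1n.
  have nm : (m%:R : R) <= n%:R by rewrite ler_nat.
  have vle : (1 - e) * v p <= (1 - e) * (n%:R * L + `|A2|).
    rewrite ler_wpM2l; [by []|lra|].
    have := ler_wpM2r L0 nm; have := ler_norm A2; lra.
  have A20 := normr_ge0 A2; have := ler_norm A1.
  have h1 : e * `|A2| >= 0 by rewrite mulr_ge0// ltW.
  have h2 : e * L <= n%:R * (e * L).
    by rewrite ler_peMl// mulr_ge0// ltW.
  have -> : (1 - e) * - v p = - ((1 - e) * v p) by ring.
  have : (1 - e) * (n%:R * L + `|A2|) = n%:R * L - n%:R * (e * L) + `|A2| - e * `|A2| by ring.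
  lra.
move=> p Kp; rewrite leNgt; apply/negP => uv.
have v0 := normr_ge0 (v p).
(* The limit of [key] as [e] tends to 0; this value is already small enough to contradict
   [u p < v p]. *)
pose e := Num.min (1 / 2) ((v p - u p) / (2 * (`|v p| + 1))).
have q0 : 0 < (v p - u p) / (2 * (`|v p| + 1)) by rewrite divr_gt0//; lra.
have e0 : 0 < e by rewrite lt_min q0 andbT; lra.
have e1 : e < 1 by rewrite gt_min; apply/orP; left; lra.
have := key e e0 e1 p Kp.
have : e * (2 * (`|v p| + 1)) <= v p - u p.
  by rewrite -ler_pdivlMr ?ge_min ?lexx ?orbT//; lra.
have := ler_wpM2l (ltW e0) (ler_norm (v p)).
nra.
Qed.

End PolynomialGreen.

(** * The strong minimum principle *)

Section StrongMinimumPrinciple.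
Context {R : realType}.
Implicit Types (p q : R * R) (D : set (R * R)) (w : R * R -> R).

Lemma superharm_ln_dist (c p : R * R) : 0 < cabs (of_plane p - of_plane c) ->
  superharm (fun q => ln (cabs (of_plane q - of_plane c))) p.
Proof.
set d := cabs _ => d0.
apply: (@superharm_lap_bound _ _ _ (d / 2) (2 / d ^+ 4)).
- by rewrite divr_gt0.
- by rewrite divr_ge0// exprn_ge0// ltW.
move=> t t0 td; apply: le_trans (ler_norm _) _.
exact: lap_ln_dist.
Qed.

Lemma continuous_ln_dist (c p : R * R) : 0 < cabs (of_plane p - of_plane c) ->
  {for p, continuous (fun q => ln (cabs (of_plane q - of_plane c)))}.
Proof.
move=> d0.
apply: (@continuous_comp _ _ _ (fun q => cabs (of_plane q - of_plane c)) (@ln R)).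
  exact: continuous_cabs_dist.
exact: continuous_ln.
Qed.

Lemma open_annulus (c : R * R) (a b : R) :
  open [set q | a < cabs (of_plane q - of_plane c) < b].
Proof.
rewrite openE => p /andP[pa pb].
have h1 := nbhs_cabs_lt pb.
have h2 : \forall q \near p, a < cabs (of_plane q - of_plane c).
  exact: (cvgr_gt _ (@continuous_cabs_dist R (of_plane c) p) a pa).
by apply: filterS2 h1 h2 => q h3 h4; rewrite /= h4.
Qed.

Lemma compact_annulus (c : R * R) (a b : R) :
  compact [set q | a <= cabs (of_plane q - of_plane c) <= b].
Proof.
have -> : [set q | a <= cabs (of_plane q - of_plane c) <= b] =
    [set q | a <= cabs (of_plane q - of_plane c)] `&` [set q | cabs (of_plane q - of_plane c) <= b].
  by apply/seteqP; split=> q /= => [/andP[]|[-> ->]].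
have cl : closed ([set q | a <= cabs (of_plane q - of_plane c)] `&` [set q | cabs (of_plane q - of_plane c) <= b]).
  apply: closedI.
    apply: (closed_comp (f := fun q => cabs (of_plane q - of_plane c)) (D := [set x | a <= x])).
      by move=> q _; exact: continuous_cabs_dist.
    exact: closed_ge.
  apply: (closed_comp (f := fun q => cabs (of_plane q - of_plane c)) (D := [set x | x <= b])).
    by move=> q _; exact: continuous_cabs_dist.
  exact: closed_le.
apply: (subclosed_compact cl (@compact_cabs_le R (b + cabs (of_plane c)))) => q [_ /= qb].
have := cabsD (of_plane q - of_plane c) (of_plane c); rewrite subrK => h.
by apply: le_trans h _; rewrite lerD2r.
Qed.

(* If [w c > 0], comparing [w] with a multiple of [ln (R / |z - c|)] on an
   annulus around [c] shows that [w > 0] on the whole disc around [c]. *)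
Lemma superharm_zero_open D w : open D ->
  (forall p, D p -> {for p, continuous w}) -> (forall p, D p -> superharm w p) ->
  (forall p, D p -> 0 <= w p) ->
  forall p, D p -> w p = 0 -> \forall q \near p, w q = 0.
Proof.
move=> oD cw sw w_ge0 p Dp wp.
have [r r0 rD] := ball_cabsP (open_nbhs_nbhs (conj oD Dp)).
(* The disc of radius [2 * rho] around a point [c] within [rho] of [p] stays inside the disc of
   radius [r] around [p]. *)
pose rho := r / 3; have rho0 : 0 < rho by rewrite divr_gt0.
have : \forall c \near p, cabs (of_plane c - of_plane p) < rho.
  by apply: nbhs_cabs_lt; rewrite subrr cabs0.
apply: filterS => c cp; apply/eqP; case: eqP => // /eqP wc0; exfalso.
have Dc : D c by apply: rD; apply: lt_trans cp _; rewrite /rho; lra.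
have wc : 0 < w c by rewrite lt_def wc0 w_ge0.
pose d := w c / 2; have d0 : 0 < d by rewrite divr_gt0.
have dw : d < w c by rewrite /d; lra.
have [s1 s10 hs1] := ball_cabsP (cvgr_gt _ (cw _ Dc) d dw).
pose s := Num.min s1 rho; have s0 : 0 < s by rewrite lt_min s10.
have ss1 : s <= s1 by rewrite ge_min lexx.
have srho : s <= rho by rewrite ge_min lexx orbT.
have hs q : cabs (of_plane q - of_plane c) < s -> d < w q.
  by move=> qs; apply: hs1; exact: lt_le_trans qs ss1.
have [ps|ps] := ltP (cabs (of_plane p - of_plane c)) s.
  by have := hs _ ps; rewrite wp; lra.
have l0 : 0 < ln (2 * rho) - ln (s / 2).
  rewrite subr_gt0 ltr_ln ?posrE; [lra|lra|lra].
(* The barrier [k * (ln (2 * rho) - ln |q - c|)] is 0 on the outer circle and [d] on the inner one,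
   of radius [s / 2]; [w > d] holds up to radius [s], hence past the inner circle. *)
pose k := d / (ln (2 * rho) - ln (s / 2)); have k0 : 0 < k by rewrite divr_gt0.
have kE : k * (ln (2 * rho) - ln (s / 2)) = d by rewrite /k mulfVK// gt_eqF.
pose f q := w q + (k * ln (cabs (of_plane q - of_plane c)) + - (k * ln (2 * rho))).
have AD q : s / 2 < cabs (of_plane q - of_plane c) < 2 * rho -> D q.
  move=> /andP[_ qc]; apply: rD.
  have := cabsD (of_plane q - of_plane c) (of_plane c - of_plane p).
  by rewrite addrA subrK /rho in qc cp *; lra.
have fp : 0 <= f p.
  apply: (@min_principle R [set q | s / 2 < cabs (of_plane q - of_plane c) < 2 * rho] f).
  - exact: open_annulus.
  - move=> q /[dup] /andP[q1 _] /AD Dq; have q0 : 0 < cabs (of_plane q - of_plane c) by lra.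
    apply: cvgD; first exact: cw.
    apply: cvgD; last exact: cvg_cst.
    by apply: cvgM; [exact: cvg_cst|exact: continuous_ln_dist].
  - move=> q /[dup] /andP[q1 _] /AD Dq; have q0 : 0 < cabs (of_plane q - of_plane c) by lra.
    apply: superharmD; first exact: sw.
    apply: superharmD; last exact: superharm_cst.
    by apply: superharmZ; [exact: ltW|exact: superharm_ln_dist].
  - move=> e e0.
    have ek : 0 < e / k by rewrite divr_gt0.
    have ex1 : expR (- (e / k)) < 1 by rewrite expR_lt1 oppr_lt0.
    (* On the inner rim left out, [w > d] beats the barrier; on the outer rim the barrier is below
       [e], which fixes the factor [expR (- (e / k))]. *)
    exists [set q | 3 / 4 * s <= cabs (of_plane q - of_plane c) <= 2 * rho * expR (- (e / k))].
      exact: compact_annulus.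
    split=> [q /andP[q1 q2]|q /andP[q1 q2]].
      apply/andP; split; first lra.
      by apply: le_lt_trans q2 _; rewrite gtr_pMr//; lra.
    have q0 : 0 < cabs (of_plane q - of_plane c) by lra.
    move/negP; rewrite negb_and -!ltNge => /orP[q3|q3].
      have wq : d < w q by apply: hs; lra.
      have : ln (s / 2) <= ln (cabs (of_plane q - of_plane c)).
        by rewrite ler_ln ?posrE; lra.
      move=> /(ler_wpM2l (ltW k0)); rewrite /f; lra.
    have wq : 0 <= w q by apply: w_ge0; apply: AD; rewrite q1.
    have : ln (2 * rho * expR (- (e / k))) <= ln (cabs (of_plane q - of_plane c)).
      by rewrite ler_ln ?posrE ?ltW// mulr_gt0 ?expR_gt0//; lra.
    rewrite lnM ?posrE ?expR_gt0//; last lra.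
    rewrite expRK => /(ler_wpM2l (ltW k0)).
    have -> : k * (ln (2 * rho) + - (e / k)) = k * ln (2 * rho) - e by field; rewrite gt_eqF.
    by rewrite /f; lra.
  - apply/andP; split; first lra.
    by rewrite cabs_distC; lra.
move: fp; rewrite /f wp add0r -mulrBr pmulr_rge0// subr_ge0 leNgt => /negP; apply.
rewrite ltr_ln ?posrE; [by rewrite cabs_distC; lra|lra|lra].
Qed.

Definition seg p q (t : R) : R * R :=
  ((1 - t) * p.1 + t * q.1, (1 - t) * p.2 + t * q.2).

(** Connectedness of [[0, 1]]: the parameters where [w] vanishes form a relatively open set by
    [superharm_zero_open] and a relatively closed one by continuity. *)
Lemma superharm_zero_segment D w p q : open D ->
  (forall p, D p -> {for p, continuous w}) -> (forall p, D p -> superharm w p) ->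
  (forall p, D p -> 0 <= w p) ->
  (forall t, 0 <= t <= 1 -> D (seg p q t)) -> w p = 0 -> w q = 0.
Proof.
move=> oD cw sw w0 Dseg wp.
have cseg : continuous (seg p q).
  move=> t; apply: (@cvg_pair _ _ _ _ (nbhs _) (nbhs _)).
    apply: cvgD; apply: cvgM; try exact: cvg_cst; last exact: cvg_id.
    by apply: cvgB; [exact: cvg_cst|exact: cvg_id].
  apply: cvgD; apply: cvgM; try exact: cvg_cst; last exact: cvg_id.
  by apply: cvgB; [exact: cvg_cst|exact: cvg_id].
pose B := [set t : R | 0 <= t <= 1 /\ w (seg p q t) = 0].
have seg0 : seg p q 0 = p.
  by rewrite /seg subr0 !mul1r !mul0r !addr0 -surjective_pairing.
have seg1 : seg p q 1 = q.
  by rewrite /seg subrr !mul1r !mul0r !add0r -surjective_pairing.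
have : B = `[0, 1]%classic.
  apply: (@segment_connected R 0 1).
  - by exists 0; split; [rewrite lexx ler01|rewrite seg0].
  - exists [set t | w (seg p q t) = 0]°; first exact: open_interior.
    apply/seteqP; split=> t.
      move=> [t01 wt]; split; first by rewrite /= in_itv.
      have h : nbhs (seg p q t) [set y | w y = 0].
        exact: (superharm_zero_open oD cw sw w0 (Dseg _ t01) wt).
      exact: (cseg t _ h).
    by move=> [/=]; rewrite in_itv/= => t01 /interior_subset wt; split.
  - exists (~` [set t | 0 < w (seg p q t)]°).
      by apply: open_closedC; exact: open_interior.
    apply/seteqP; split=> t.
      move=> [t01 wt]; split; first by rewrite /= in_itv.
      by move=> /interior_subset /=; rewrite wt ltxx.
    move=> [/=]; rewrite in_itv/= => t01 nt; split => //.
    apply/eqP; case: eqP => // /eqP wt; exfalso; apply: nt.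
    have wt0 : 0 < w (seg p q t) by rewrite lt_def wt w0//; exact: Dseg.
    have h : nbhs (seg p q t) [set y | 0 < w y].
      exact: (cvgr_gt _ (cw _ (Dseg _ t01)) _ wt0).
    exact: (cseg t _ h).
move=> BE; have : B 1 by rewrite BE /= in_itv/= ler01 lexx.
by case=> _; rewrite seg1.
Qed.

(** A segment from a point of the closed upper half-plane off [K] to [(0, 1)] can meet the real axis
    only at its starting point, and so in the lower half-plane with [(0, -1)]. The point [(x0, 0)]
    sees both hubs and links the two half-planes. *)
Lemma superharm_zero_everywhere (K : set (R * R)) (x0 : R) w :
  open (~` K) -> (forall p, K p -> p.2 = 0) -> ~ K (x0, 0) ->
  (forall p, ~ K p -> {for p, continuous w}) -> (forall p, ~ K p -> superharm w p) ->
  (forall p, ~ K p -> 0 <= w p) ->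
  forall p q, ~ K p -> ~ K q -> w p = 0 -> w q = 0.
Proof.
move=> oK K2 Kx0 cw sw w0.
have Z p q : (forall t, 0 <= t <= 1 -> ~ K (seg p q t)) -> w p = 0 <-> w q = 0.
  move=> h; split; first exact: (superharm_zero_segment oK cw sw w0 h).
  apply: (superharm_zero_segment oK) => // t t01.
  have -> : seg q p t = seg p q (1 - t).
    by rewrite /seg; congr (_, _); ring.
  by apply: h; lra.
have hub p (s : R) : ~ K p -> 0 <= s * p.2 -> s != 0 -> w p = 0 <-> w (0, s) = 0.
  move=> Kp sp s0; apply: Z => t t01 /[dup] Kt /K2 /= h.
  have [t0|t0] := eqVneq t 0.
    move: Kt; rewrite t0 /seg subr0 !mul1r !mul0r !addr0 -surjective_pairing; exact: Kp.
  have : 0 < t * s ^+ 2 by rewrite mulr_gt0 ?exprn_even_gt0// lt_def t0; lra.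
  have : 0 <= (1 - t) * (s * p.2) by rewrite mulr_ge0//; lra.
  have : s * ((1 - t) * p.2 + t * s) = 0 by rewrite h mulr0.
  by nra.
have up p : ~ K p -> w p = 0 <-> w (0, 1) = 0.
  move=> Kp; have [p2|p2] := leP 0 p.2.
    by apply: hub; rewrite ?mul1r// oner_eq0.
  have h1 := @hub p (-1) Kp; have h2 := @hub (x0, 0) (-1) Kx0; have h3 := @hub (x0, 0) 1 Kx0.
  rewrite /= !mulr0 lexx oppr_eq0 oner_eq0 in h1 h2 h3.
  by rewrite h1// ?mulN1r; [rewrite -h2// h3|lra].
by move=> p q Kp Kq; rewrite (up p Kp) (up q Kq).
Qed.

End StrongMinimumPrinciple.

(** * The Green's function of a closed subset of the real line *)

Section GreenFunction.
Context {R : realType}.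
Context (K : set R[i]) (g : R[i] -> R) (x0 : R).
Context (green_g : is_green K g)
  (closed_K : closed (@of_plane R @^-1` K))
  (real_K : forall z, K z -> Im z = 0) (Kx0 : ~ K x0%:C).
Implicit Types (T : {poly R[i]}) (p q : R * R).

Let Kp := @of_plane R @^-1` K.
Let gp p := g (of_plane p).

Let oK : open (~` Kp). Proof. exact: closed_openC. Qed.

Let cont_g p : ~ Kp p -> {for p, continuous gp}.
Proof. by case: green_g => hg _ _; exact: (harmonic_on_continuous oK hg). Qed.

Let superharm_g p : ~ Kp p -> superharm gp p.
Proof. by case: green_g => hg _ _ Kpp; have [] := harmonic_on_superharm oK hg Kpp. Qed.

Let subharm_g p : ~ Kp p -> superharm (fun q => - gp q) p.
Proof. by case: green_g => hg _ _ Kpp; have [] := harmonic_on_superharm oK hg Kpp. Qed.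

Let contM (k : R) p : ~ Kp p -> {for p, continuous (fun q => k * gp q)}.
Proof. by move=> Kpp; apply: cvgM; [exact: cvg_cst|exact: cont_g]. Qed.

(** Comparison with the zero function, whose growth exponent is [m = 0]. *)
Lemma green_ge0 z : ~ K z -> 0 <= g z.
Proof.
rewrite -(of_planeK z).
apply: (@log_growth_comparison R Kp 1 0 gp (fun=> 0)) => //.
- by move=> p _; exact: cvg_cst.
- by move=> p _; rewrite oppr0; exact: superharm_cst.
- exact: vanishes_at_green.
- by move=> e e0; exists set0; split=> [||p _ _]; [exact: closed0|exact: sub0set|rewrite normr0 ltW].
- exact: green_log_growth green_g.
- by exists 0, 1; split=> // p _; rewrite mul0r subrr normr0.
Qed.

(** A zero would spread to the whole complement of [K], against the growth of [g] at the point
    [(0, s)], where [ln s > A]. *)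
Lemma green_gt0 z : ~ K z -> 0 < g z.
Proof.
move=> Kz; rewrite lt_def green_ge0// andbT; apply/eqP => gz.
have [A [r [r0 hA]]] := green_log_growth green_g.
pose s := r + expR A.
have s0 : 0 < s by rewrite addr_gt0// expR_gt0.
have K0s : ~ Kp (0, s) by move=> /real_K /= s_eq0; move: s0; rewrite s_eq0 ltxx.
have Z : gp (0, s) = 0.
  apply: (@superharm_zero_everywhere R Kp x0 gp oK _ _ cont_g superharm_g _ (Re z, Im z)) => //.
  - by move=> p /real_K.
  - by move=> p Kpp; exact: green_ge0.
  - by rewrite /Kp /preimage /mkset of_planeK.
  - by rewrite /gp of_planeK.
have cs : cabs (of_plane (0, s)) = s by rewrite cabsE /= expr0n add0r sqrtr_sqr gtr0_norm.
have := hA (0, s); rewrite -/(gp _) Z cs mul1r sub0r normrN => h.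
have /h : r <= s by rewrite lerDl expR_ge0.
have : A < ln s by rewrite -[ltLHS]expRK ltr_ln ?posrE ?expR_gt0// ltrDr.
have := ler_norm (ln s); lra.
Qed.

Context (T : {poly R[i]}) (n : nat).
Context (n0 : (0 < n)%N) (sT : size T = n.+1).

Lemma green_poly_eq0 p : green_poly T p = 0 <-> poly_preimage T (of_plane p).
Proof. exact: green_seg_eq0. Qed.

Lemma green_poly_le_green z : K `<=` poly_preimage T -> ~ K z ->
  green_seg T.[z] <= n%:R * g z.
Proof.
move=> KT; rewrite -(of_planeK z).
apply: (@log_growth_comparison R Kp n n (fun p => n%:R * gp p) (green_poly T)) => //.
- exact: contM.
- by move=> p _; exact: green_poly_continuous.
- by move=> p Kpp; apply: superharmZ => //; exact: superharm_g.
- by move=> p _; exact: subharm_green_poly sT.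
- by apply: vanishes_atZ; exact: vanishes_at_green.
- by apply: vanishes_at_green_poly => p /KT /green_poly_eq0.
- by apply: log_growthZ; exact: green_log_growth green_g.
- exact: log_growth_green_poly.
Qed.

Lemma green_eq_green_poly z : poly_preimage T = K -> ~ K z ->
  n%:R * g z = green_seg T.[z].
Proof.
move=> KT Kz; apply/eqP; rewrite eq_le green_poly_le_green ?KT// andbT.
move: z Kz => z; rewrite -(of_planeK z).
apply: (@log_growth_comparison R Kp n n (green_poly T) (fun p => n%:R * gp p)) => //.
- by move=> p _; exact: green_poly_continuous.
- exact: contM.
- move=> p Kpp; apply: superharm_green_poly sT _ => //.
  rewrite lt_def green_seg_ge0 andbT; apply/eqP => /green_poly_eq0.
  by rewrite KT.
- move=> p Kpp.
  have -> : (fun q => - (n%:R * gp q)) = (fun q => n%:R * - gp q).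
    by apply/funext => q; rewrite mulrN.
  by apply: superharmZ => //; exact: subharm_g.
- by apply: vanishes_at_green_poly => p; rewrite /Kp -KT => /green_poly_eq0.
- by apply: vanishes_atZ; exact: vanishes_at_green.
- exact: log_growth_green_poly.
- by apply: log_growthZ; exact: green_log_growth green_g.
Qed.

(** At a point of the preimage outside [K] the function [green_poly T] is 0, so the spread equality
    would give [g = 0] there, against [green_gt0]. *)
Lemma green_eq_preimage z : K `<=` poly_preimage T -> ~ K z ->
  n%:R * g z = green_seg T.[z] -> poly_preimage T = K.
Proof.
move=> KT Kz gT; apply/seteqP; split => // y yT; apply: contrapT => Ky.
pose w p := n%:R * gp p + - green_poly T p.
have : w (Re y, Im y) = 0.
  apply: (@superharm_zero_everywhere R Kp x0 w oK _ _ _ _ _ (Re z, Im z)) => //.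
  - by move=> p /real_K.
  - move=> p Kpp; apply: cvgD; first exact: contM.
    by apply: cvgN; exact: green_poly_continuous.
  - move=> p Kpp; apply: superharmD; last exact: subharm_green_poly sT.
    by apply: superharmZ => //; exact: superharm_g.
  - by move=> p Kpp; rewrite subr_ge0; exact: green_poly_le_green.
  - by rewrite /Kp /preimage /mkset of_planeK.
  - by rewrite /Kp /preimage /mkset of_planeK.
  - by rewrite /w /gp /green_poly of_planeK gT subrr.
have v0 : green_poly T (Re y, Im y) = 0.
  by apply/green_poly_eq0; rewrite of_planeK.
rewrite /w v0 oppr0 addr0 /gp of_planeK => /eqP.
by rewrite mulf_eq0 pnatr_eq0 -leqn0 leqNgt n0 /= gt_eqF// green_gt0.
Qed.

End GreenFunction.

(** * Real and imaginary parts of polynomials *)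

Section ExtremalPoints.
Context {F : numClosedFieldType}.

(* Away from the repeated roots, which are critical points of [T], the roots
   of [T ^+ 2 - 1] are simple: it divides [S * T^`()], whose degree is smaller. *)
Lemma eq0_of_sqr_eq1_roots (T S : {poly F}) n : (0 < n)%N -> size T = n.+1 ->
  (size S <= n.+1)%N -> (forall z, T.[z] ^+ 2 = 1 -> S.[z] = 0) -> S = 0.
Proof.
move=> n0 sT sS ST; apply/eqP; apply: contraT => S0.
pose W := T ^+ 2 - 1.
have T0 : T != 0 by rewrite -size_poly_gt0 sT.
have sT2 : size (T ^+ 2) = (n + n).+1.
  by rewrite expr2 size_mul// sT /= addnS.
have sW : size W = (n + n).+1.
  by rewrite /W size_polyDl sT2// size_polyN size_poly1 ltnS addn_gt0 n0.
have W0 : W != 0 by rewrite -size_poly_gt0 sW.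
(* [H] is the squarefree part of [W]: its roots are simple and are roots of [W], hence of [S]. *)
pose G := gcdp W W^`(); pose H := W %/ G.
have GW : G %| W by exact: dvdp_gcdl.
have WE : H * G = W by rewrite divpK.
have HS : H %| S.
  have H0 : H != 0 by apply: contraNneq W0 => H0; rewrite -WE H0 mul0r.
  have [rs Hrs] := closed_field_poly_normal H.
  have rH a : a \in rs -> root H a.
    by move=> ars; rewrite Hrs rootZ ?lead_coef_eq0// root_prod_XsubC.
  have urs : uniq rs.
    have := make_separable W0; rewrite -/G -/H Hrs.
    have lc : lead_coef H != 0 by rewrite lead_coef_eq0.
    by rewrite (eqp_separable (eqp_scale _ lc)) separable_prod_XsubC.
  rewrite Hrs dvdpZl ?lead_coef_eq0//; apply: uniq_roots_dvdp; last by rewrite uniq_rootsE.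
  apply/allP => a /rH Ha; apply/eqP/ST.
  have : root W a by rewrite -WE rootM Ha.
  by rewrite /root /W hornerD hornerN hornerC horner_exp subr_eq0 => /eqP.
have dT0 : T^`() != 0.
  apply/eqP => dT; have := coef_deriv T n.-1; rewrite dT coef0 prednK// => /esym/eqP.
  by rewrite mulrn_eq0 eqn0Ngt n0 /= -[n]/(n.+1.-1) -sT -lead_coefE lead_coef_eq0 (negPf T0).
have GT : G %| T^`().
  have dW : W^`() = 2 *: (T * T^`()).
    by rewrite /W derivB derivC subr0 expr2 derivM scaler_nat mulr2n mulrC.
  have : G %| T * T^`() by rewrite -(@dvdpZr _ 2) ?pnatr_eq0// -dW dvdp_gcdr.
  rewrite Gauss_dvdpr//.
  (* [T] is coprime to [W], because [T * T - W = 1]. *)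
  apply: coprimep_dvdr GW _; rewrite /W expr2 coprimep_sym.
  apply/coprimepP => d dvT dvW; rewrite -size_poly_eq1 -dvdp1.
  have -> : 1 = T * T + - (T * T - 1) by rewrite opprB addrC subrK.
  by rewrite dvdp_add ?dvdpNr// dvdp_mull.
(* Sizes conflict: [W] has size [2 n + 1], the product at most [n.+1 + n - 1 = 2 n]. *)
have : W %| S * T^`() by rewrite -WE dvdp_mul.
move=> /dvdp_leq; rewrite mulf_neq0// sW size_mul// => /(_ isT).
have : (size T^`() <= n)%N by rewrite -ltnS -sT lt_size_deriv.
move: sS n0; move: (size S) (size T^`()) => s d; lia.
Qed.

End ExtremalPoints.

Section RealAndImaginaryParts.
Context {R : realType}.
Implicit Types (P : {poly R[i]}) (z w : R[i]).

(** Parts are taken coefficientwise, which keeps polynomials; on real arguments the values are the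
    parts of those of [P]. The degree may drop. *)
Definition re_poly P : {poly R[i]} := \poly_(i < size P) (Re P`_i)%:C.
Definition im_poly P : {poly R[i]} := \poly_(i < size P) (Im P`_i)%:C.

Lemma horner_re_poly P (x : R) : (re_poly P).[x%:C] = (Re P.[x%:C])%:C.
Proof.
rewrite horner_poly horner_coef.
rewrite (big_morph (fun z => (Re z)%:C) (id1 := 0) (op1 := +%R)) => [|[a b] [c d]|] //=; last first.
  by apply/eqP; rewrite eq_complex/= addr0 !eqxx.
apply: eq_bigr => i _; rewrite -rmorphXn/=; case: (P`_i) => a b.
by apply/eqP; rewrite eq_complex/=; apply/andP; split; apply/eqP; ring.
Qed.

Lemma horner_im_poly P (x : R) : (im_poly P).[x%:C] = (Im P.[x%:C])%:C.
Proof.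
rewrite horner_poly horner_coef.
rewrite (big_morph (fun z => (Im z)%:C) (id1 := 0) (op1 := +%R)) => [|[a b] [c d]|] //=; last first.
  by apply/eqP; rewrite eq_complex/= addr0 !eqxx.
apply: eq_bigr => i _; rewrite -rmorphXn/=; case: (P`_i) => a b.
by apply/eqP; rewrite eq_complex/=; apply/andP; split; apply/eqP; ring.
Qed.

Lemma re_poly_id P : im_poly P = 0 -> re_poly P = P.
Proof.
move=> iP; apply/polyP => i; have /polyP/(_ i) := iP; rewrite !coef_poly coef0.
case: ltnP => [_|si]; last by rewrite nth_default.
by case: (P`_i) => a b /= [->].
Qed.

End RealAndImaginaryParts.

(** * Finite unions of real intervals *)

Section RealIntervals.
Context {R : realType}.
Context (l : nat) (a : nat -> R).
Context (l_gt0 : (0 < l)%N)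
  (a_incr : forall i j : nat, (i < j)%N -> (j < l.*2)%N -> a i < a j).
Local Notation K := (real_intervals l a).

Lemma real_intervals_Im z : K z -> Im z = 0.
Proof. by case=> k [x [_ _ ->]]. Qed.

Lemma closed_real_intervals : closed (@of_plane R @^-1` K).
Proof.
have -> : @of_plane R @^-1` K =
    \bigcup_(k in `I_l) (`[a k.*2, a k.*2.+1]%classic `*` [set 0]).
  apply/seteqP; split=> [[x y] [k [t [kl tk [-> ->]]]]|[x y] [k kl [/= xk ->]]].
    by exists k => //; split => //=; rewrite in_itv.
  by exists k, x; split=> //; move: xk; rewrite in_itv.
apply: closed_bigcup => // k _.
apply: compact_closed; first exact: norm_hausdorff.
by apply: compact_setX; [exact: segment_compact|exact: compact_set1].
Qed.

Lemma real_intervals_bounds z : K z -> a 0%N <= Re z <= a l.*2.-1.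
Proof.
move=> [k [x [kl /andP[x1 x2] ->]]] /=; apply/andP; split.
  apply: le_trans x1; case: k kl {x2} => [//|k] kl.
  by apply/ltW/a_incr => //; lia.
apply: le_trans x2 _; have [->//|ne] := eqVneq k.*2.+1 l.*2.-1.
by apply/ltW/a_incr; lia.
Qed.

Lemma real_intervals_first (x : R) : a 0%N <= x <= a 1%N -> K x%:C.
Proof. by move=> ax; exists 0%N, x. Qed.

Lemma notin_real_intervals : ~ K (a 0%N - 1)%:C.
Proof. by move=> /real_intervals_bounds /= /andP[]; lra. Qed.

Lemma cabs_real_intervals z : K z -> cabs z <= `|a 0%N| + `|a l.*2.-1|.
Proof.
move=> Kz; have /andP[h1 h2] := real_intervals_bounds Kz.
have -> : z = (Re z)%:C by have := real_intervals_Im Kz; case: (z) => x y /= ->.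
rewrite cabs_real ler_norml; have := ler_norm (- a 0%N); have := ler_norm (a l.*2.-1).
have := normr_ge0 (a 0%N); have := normr_ge0 (a l.*2.-1).
by rewrite normrN => *; apply/andP; split; lra.
Qed.

Lemma poly_norm_ub (P : {poly R[i]}) z : K z -> cabs P.[z] <= poly_norm K P.
Proof.
move=> Kz; apply: ub_le_sup; last by exists z.
have cK : compact (@of_plane R @^-1` K).
  apply: (subclosed_compact closed_real_intervals (@compact_cabs_le R (`|a 0%N| + `|a l.*2.-1|))).
  by move=> p; exact: cabs_real_intervals.
have K0 : (@of_plane R @^-1` K) !=set0.
  by exists (Re z, Im z); rewrite /preimage /mkset of_planeK.
have [|c _ cmax] := @compact_EVT_max _ R (fun p => cabs P.[of_plane p]) _ K0 cK.
  exact/continuous_subspaceT/continuous_cabs_horner.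
exists (cabs P.[of_plane c]) => _ [w Kw <-].
by have := cmax (Re w, Im w); rewrite inE /preimage /mkset of_planeK; apply.
Qed.

Lemma eq0_on_real_intervals (P : {poly R[i]}) : (forall z, K z -> P.[z] = 0) -> P = 0.
Proof.
move=> PK; apply/eqP; apply: contraT => P0.
have a01 : a 0%N < a 1%N by apply: a_incr => //; lia.
(* Distinct points of the first interval; [size P] of them is one more than the degree allows as
   roots. *)
pose pt (i : nat) : R := a 0%N + (a 1%N - a 0%N) * (i.+1%:R)^-1.
have := @max_poly_roots _ P [seq (pt i)%:C | i <- iota 0 (size P)] P0.
rewrite size_map size_iota ltnn; apply.
- apply/allP => _ /mapP[i _ ->]; apply/eqP/PK/real_intervals_first.
  have h1 : 0 < (i.+1%:R : R)^-1 by rewrite invr_gt0.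
  have h2 : (i.+1%:R : R)^-1 <= 1 by rewrite invf_le1// ler1n.
  have D0 : 0 < a 1%N - a 0%N by rewrite subr_gt0.
  rewrite /pt lerDl mulr_ge0 ?(ltW D0) ?(ltW h1)//=.
  by rewrite -lerBrDl ler_piMr// ltW.
- rewrite map_inj_uniq ?iota_uniq// => i j [] /addrI /mulfI h.
  have /h/invr_inj : a 1%N - a 0%N != 0 by rewrite subr_eq0 gt_eqF.
  by move/eqP; rewrite eqr_nat => /eqP[].
Qed.

End RealIntervals.

Section HyperbolicCosine.
Context {R : realType}.
Implicit Types s t : R.

Lemma cosh_lt s t : 0 <= s -> s < t ->
  (expR s + expR (- s)) / 2 < (expR t + expR (- t)) / 2.
Proof.
move=> s0 st; rewrite ltr_pM2r ?invr_gt0// !expRN.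
have u1 : 1 <= expR s by rewrite -expR0 ler_expR.
have uv : expR s < expR t by rewrite ltr_expR.
move: (expR s) (expR t) u1 uv => u v u1 uv.
rewrite -subr_gt0.
have -> : v + v^-1 - (u + u^-1) = (v - u) * (u * v - 1) / (u * v).
  by field; rewrite !gt_eqF//; lra.
have uv1 : 1 < u * v by nra.
by rewrite divr_gt0 ?mulr_gt0//; lra.
Qed.

Lemma cosh_gt1 t : 0 < t -> 1 < (expR t + expR (- t)) / 2.
Proof. by move=> /(cosh_lt (lexx 0)); rewrite oppr0 expR0; lra. Qed.

End HyperbolicCosine.

(** * The inequality and the case of equality *)

Theorem corollary3 (R : realType) (l : nat) (a : nat -> R)
    (l_gt0 : (0 < l)%N)
    (a_incr : forall i j : nat, (i < j)%N -> (j < l.*2)%N -> a i < a j)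
    (g : R[i] -> R) (g_green : is_green (real_intervals l a) g)
    (n : nat) (n_gt0 : (0 < n)%N)
    (Q : {poly R[i]}) (Q_deg : size Q = n.+1)
    (x : R) (x_notin : ~ real_intervals l a x%:C) :
  let K := real_intervals l a in
  let lhs := cabs Q.[x%:C] / poly_norm K Q in
  let rhs := (expR (n%:R * g x%:C) + expR (- (n%:R * g x%:C))) / 2 in
  lhs <= rhs /\
  (lhs = rhs <-> exists c : R[i], c != 0 /\ poly_preimage (c *: Q) = K).
Proof.
move=> K lhs rhs.
have cK := @closed_real_intervals R l a.
have rK z : K z -> Im z = 0 by exact: real_intervals_Im.
have Kr z : K z -> exists2 y : R, z = y%:C & K y%:C.
  move=> Kz; have zE : z = (Re z)%:C by have := rK _ Kz; case: (z) => b c /= ->.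
  by exists (Re z); rewrite -zE.
have K0 : K (a 0%N)%:C.
  by apply: real_intervals_first => //; rewrite lexx ltW// a_incr//; lia.
have g0 : 0 < g x%:C.
  exact: (green_gt0 g_green cK rK (notin_real_intervals l_gt0 a_incr)).
have n1 : (0 : R) < n%:R by rewrite ltr0n.
have rhs1 : 1 < rhs by apply: cosh_gt1; rewrite mulr_gt0.
have M0 : 0 < poly_norm K Q.
  rewrite lt_def (le_trans (cabs_ge0 _) (poly_norm_ub l_gt0 a_incr Q K0)) andbT.
  apply/eqP => M0; have : Q = 0.
    apply: (eq0_on_real_intervals l_gt0 a_incr) => z Kz; apply/eqP.
    by rewrite -cabs_eq0 eq_le cabs_ge0 andbT -M0; exact: poly_norm_ub.
  by move=> Q0; move: Q_deg; rewrite Q0 size_poly0.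
have lhs0 : 0 <= lhs by rewrite divr_ge0 ?cabs_ge0// ltW.
have [lam [lam0 lamM lamx]] : exists lam : R[i],
    [/\ lam != 0, cabs lam = (poly_norm K Q)^-1 & lam * Q.[x%:C] = lhs%:C].
  have Mc : cabs (poly_norm K Q)^-1%:C = (poly_norm K Q)^-1.
    by rewrite cabs_real ger0_norm// invr_ge0 ltW.
  (* Without a value at [x] to rotate, scaling alone is enough. *)
  have [q0|q0] := eqVneq Q.[x%:C] 0.
    exists (poly_norm K Q)^-1%:C; split => //.
      by rewrite -cabs_gt0 Mc invr_gt0.
    by rewrite q0 mulr0 /lhs q0 cabs0 mul0r.
  have cq : 0 < cabs Q.[x%:C] by rewrite cabs_gt0.
  have lc : cabs (lhs%:C / Q.[x%:C]) = (poly_norm K Q)^-1.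
    by rewrite cabsM cabsV cabs_real ger0_norm// /lhs mulrAC divff ?mul1r// gt_eqF.
  exists (lhs%:C / Q.[x%:C]); split => //; last by rewrite divfK.
  by rewrite -cabs_gt0 lc invr_gt0.
pose P := lam *: Q; pose T := re_poly P.
have PK z : K z -> cabs P.[z] <= 1.
  move=> Kz; rewrite hornerZ cabsM lamM mulrC ler_pdivrMr// mul1r.
  exact: poly_norm_ub.
have KT : K `<=` poly_preimage T.
  move=> z /Kr[y -> Ky]; exists (Re P.[y%:C]); last exact: horner_re_poly.
  by rewrite -ler_norml; exact: le_trans (ge_Re_cabs _) (PK _ Ky).
have Tx : T.[x%:C] = lhs%:C by rewrite horner_re_poly hornerZ lamx.
have sT : (size T <= n.+1)%N by rewrite (leq_trans (size_poly _ _))// size_scale// Q_deg.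
(* Taking the real part may lower the degree to some [m < n]; then [m * g < n * g] at [x], as
   [g > 0], and the inequality is strict. *)
have main : lhs < rhs \/ (size T = n.+1 /\ n%:R * g x%:C = green_seg T.[x%:C]).
  have [l1|l1] := leP lhs 1; first by left; exact: le_lt_trans rhs1.
  have lT : lhs = (expR (green_seg T.[x%:C]) + expR (- green_seg T.[x%:C])) / 2.
    by rewrite cosh_green_seg Tx foci_mean_real ger0_norm// ltW.
  (* A constant [T] would have the same value at [x] as on [K], at most 1, against [lhs > 1]. *)
  have [m m0 sTm] : exists2 m, (0 < m)%N & size T = m.+1.
    case sTE: (size T) => [|[|m]]; last by exists m.+1.
      move: Tx; rewrite (size_poly_leq0P _ (eq_leq sTE)) hornerC => -[h].
      by move: l1; rewrite -h ltr10.
    have [t /andP[_ t1]] := KT _ K0.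
    rewrite [T]size1_polyC ?sTE// hornerC => c0.
    move: Tx; rewrite [T]size1_polyC ?sTE// hornerC c0 => -[h].
    by move: l1; rewrite -h ltNge t1.
  have mn : (m <= n)%N by rewrite -ltnS -sTm.
  have vm := green_poly_le_green g_green cK m0 sTm KT x_notin.
  have v0 := green_seg_ge0 T.[x%:C].
  have mng : m%:R * g x%:C <= n%:R * g x%:C by rewrite ler_wpM2r ?ler_nat// ltW.
  have [vn|vn] := ltP (green_seg T.[x%:C]) (n%:R * g x%:C).
    by left; rewrite lT; exact: cosh_lt.
  have nmE : n%:R * g x%:C = m%:R * g x%:C by apply/eqP; rewrite eq_le mng (le_trans vn vm).
  right; split.
    have /mulIf h : g x%:C != 0 by rewrite gt_eqF.
    by move: (nmE) => /h/eqP; rewrite eqr_nat => /eqP ->.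
  by apply/eqP; rewrite eq_le vn nmE vm.
split.
  case: main => [/ltW//|[_ gT]].
  have [l1|l1] := leP lhs 1; first by rewrite ltW// (le_lt_trans l1).
  by rewrite /rhs gT cosh_green_seg Tx foci_mean_real ger0_norm// ltW.
split=> [E|[c [c0 cT]]].
  case: main => [|[sTn gT]]; first by rewrite E ltxx.
  have TK := green_eq_preimage g_green cK rK
    (notin_real_intervals l_gt0 a_incr) n_gt0 sTn KT x_notin gT.
  exists lam; split => //; rewrite -/P -(@re_poly_id _ P) ?TK//.
  apply: (eq0_of_sqr_eq1_roots n_gt0 sTn).
    by rewrite (leq_trans (size_poly _ _))// size_scale// Q_deg.
  (* Such a [z] lies in the preimage, so in [K], and is real; there [|P| <= 1] with real part 1 or
     -1 leaves no room for an imaginary part. *)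
  move=> z Tz.
  have Kz : K z.
    rewrite /K -TK; move/eqP: Tz; rewrite sqrf_eq1 => /orP[]/eqP Tz.
      by exists 1; rewrite ?lexx ?andbT ?Tz//; lra.
    by exists (-1); rewrite ?lexx ?Tz ?rmorphN//; lra.
  have [y zy Ky] := Kr _ Kz.
  move: Tz (PK _ Ky); rewrite zy horner_re_poly horner_im_poly -rmorphXn/= => -[T2].
  rewrite -(@expr_le1 _ 2) ?cabs_ge0// sqr_cabs T2 => h.
  have /eqP : Im P.[y%:C] ^+ 2 = 0.
    by apply/eqP; rewrite eq_le sqr_ge0 andbT; lra.
  by rewrite sqrf_eq0 => /eqP ->.
pose U := c *: Q.
have sU : size U = n.+1 by rewrite size_scale.
have cc : 0 < cabs c by rewrite cabs_gt0.
have UQ z : cabs Q.[z] = cabs U.[z] / cabs c by rewrite hornerZ cabsM mulrC mulKf// gt_eqF.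
have UK z : K z -> cabs U.[z] <= 1.
  by rewrite -cT => -[t t1 ->]; rewrite cabs_real ler_norml.
have M1 : poly_norm K Q = (cabs c)^-1.
  apply/eqP; rewrite eq_le; apply/andP; split.
    apply: ge_sup; first by exists (cabs Q.[(a 0%N)%:C]), (a 0%N)%:C.
    by move=> _ [z Kz <-]; rewrite UQ ler_piMl ?invr_ge0 ?(ltW cc)//; exact: UK.
  (* The bound 1 is attained on [K]: the nonconstant [U - 1] has a root, which belongs to the
     preimage [K]. *)
  have /closed_rootP[z] : size (U - 1) != 1%N.
    by rewrite size_polyDl sU ?eqSS -?lt0n// size_polyN size_poly1.
  rewrite /root hornerD hornerN hornerC subr_eq0 => /eqP Uz.
  have Kz : K z by rewrite -cT; exists 1; [rewrite lexx andbT; lra|exact: Uz].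
  by have := poly_norm_ub l_gt0 a_incr Q Kz; rewrite UQ Uz cabs1 mul1r.
(* [U] takes real values on the infinite set [K], so its coefficients are real and its value at [x]
   is real. *)
have iU : im_poly U = 0.
  apply: (eq0_on_real_intervals l_gt0 a_incr) => z Kz.
  have [y zy Ky] := Kr _ Kz; rewrite zy horner_im_poly.
  by move: Ky; rewrite -cT => -[t _ ->].
pose t := Re U.[x%:C].
have Ux : U.[x%:C] = t%:C by rewrite -{1}(re_poly_id iU) horner_re_poly.
have t1 : 1 <= `|t|.
  rewrite leNgt; apply/negP => t1; apply: x_notin; rewrite -/K -cT; exists t => //.
  by rewrite -ler_norml ltW.
rewrite /rhs (green_eq_green_poly g_green cK n_gt0 sU cT x_notin) cosh_green_seg.
by rewrite Ux foci_mean_real// /lhs M1 invrK UQ Ux cabs_real divfK// gt_eqF.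
Qed.
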